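(* For a set $A$ the following are equivalent: (i) $A$ is BLR traceable; (ii) $A$ is low for Demuth$_{\mathrm{BLR}}$, i.e. every Demuth random set is Demuth random by $A$.
   Context: An order function is a computable nondecreasing unbounded $h:\mathbb N\to\mathbb N$. A function is $\omega$-c.e. if it is $\lim_t g(x,t)$ for a computable $g$ whose number of changes at $x$ is bounded by a computable function of $x$; it is $\omega$-c.e. by $A$ if it is $\lim_t \Gamma^A(x,t)$ for an $A$-computable $\Gamma^A$ whose number of changes at $x$ is bounded by a computable function of $x$. A BLR trace is a sequence $(T_n)$ with $T_n=W_{r(n)}$ for an $\omega$-c.e. function $r$; it has bound $h$ if $|T_n|\le h(n)$ for all $n$, and traces $f$ if $f(n)\in T_n$ for all $n$. $A$ is BLR traceable if there is an order function $h$ such that every function that is $\omega$-c.e. by $A$ is traced by some BLR trace with bound $h$. A Demuth test is a sequence $(S_m)$ of open sets $S_m=[W_{f(m)}]^\prec\subseteq 2^\omega$ with $\lambda(S_m)\le 2^{-m}$ and $f$ $\omega$-c.e.; $Z$ is Demuth random if for every Demuth test $Z\notin S_m$ for almost all $m$. $Z$ is Demuth random by $A$ if for every sequence $S_m=[W^A_{f(m)}]^\prec$ with $\lambda(S_m)\le 2^{-m}$ and $f$ $\omega$-c.e. by $A$, $Z\notin S_m$ for almost all $m$. *)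

(* Defs.v *)
From mathcomp Require Import all_boot.
Set Implicit Arguments. Unset Strict Implicit. Unset Printing Implicit Defensive.

Definition cpair (x y : nat) : nat := ((x + y) * (x + y).+1) %/ 2 + y.
Definition cnext (p : nat * nat) : nat * nat :=
  if p.1 is x.+1 then (x, p.2.+1) else (p.2.+1, 0).
Definition cunpair (n : nat) : nat * nat := iter n cnext (0, 0).

(** * Codes of unary partial recursive functionals with an oracle
    (arguments/results are naturals; tuples are coded with cpair). *)
Inductive code : Type :=
| CZero
| CSucc
| CFst
| CSnd
| COracle
| CPair of code & code
| CComp of code & code
| CRec of code & code       (* h<0,y> = f y ; h<n+1,y> = g <n,<h<n,y>,y>> *)
| CMu of code.              (* x |-> least n with f<n,x> = 0 (all earlier defined) *)

Fixpoint eval (k : nat) (A : nat -> bool) (c : code) (x : nat) {struct k}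
  : option nat :=
  match k with
  | 0 => None
  | k'.+1 =>
    match c with
    | CZero => Some 0
    | CSucc => Some x.+1
    | CFst => Some (cunpair x).1
    | CSnd => Some (cunpair x).2
    | COracle => Some (nat_of_bool (A x))
    | CPair f g =>
        match eval k' A f x, eval k' A g x with
        | Some a, Some b => Some (cpair a b)
        | _, _ => None
        end
    | CComp f g =>
        match eval k' A g x with
        | Some a => eval k' A f a
        | None => None
        end
    | CRec f g =>
        let y := (cunpair x).2 in
        let fix loop (n : nat) : option nat :=
          match n with
          | 0 => eval k' A f y
          | i.+1 => match loop i with
                    | Some r => eval k' A g (cpair i (cpair r y))
                    | None => None
                    end
          end in
        loop (cunpair x).1
    | CMu f =>
        let fix search (b i : nat) : option nat :=
          match b with
          | 0 => None
          | b'.+1 => match eval k' A f (cpair i x) with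
                     | Some 0 => Some i
                     | Some _ => search b' i.+1
                     | None => None
                     end
          end in
        search k' 0
    end
  end.

Fixpoint decode_aux (fuel n : nat) : code :=
  match fuel with
  | 0 => CZero
  | fuel'.+1 =>
    let m := n %/ 9 in
    let l := (cunpair m).1 in
    let r := (cunpair m).2 in
    match n %% 9 with
    | 0 => CZero
    | 1 => CSucc
    | 2 => CFst
    | 3 => CSnd
    | 4 => COracle
    | 5 => CPair (decode_aux fuel' l) (decode_aux fuel' r)
    | 6 => CComp (decode_aux fuel' l) (decode_aux fuel' r)
    | 7 => CRec (decode_aux fuel' l) (decode_aux fuel' r)
    | _ => CMu (decode_aux fuel' m)
    end
  end.
Definition decode (e : nat) : code := decode_aux e e.

Definition Phi (A : nat -> bool) (e x y : nat) : Prop :=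
  exists k, eval k A (decode e) x = Some y.

Definition emptyset : nat -> bool := fun _ => false.

Definition inWA (A : nat -> bool) (e x : nat) : Prop := exists y, Phi A e x y.
Definition inW (e x : nat) : Prop := inWA emptyset e x.

Definition A_computable (A : nat -> bool) (f : nat -> nat) : Prop :=
  exists e, forall x, Phi A e x (f x).
Definition computable (f : nat -> nat) : Prop := A_computable emptyset f.
Definition A_computable2 (A : nat -> bool) (g : nat -> nat -> nat) : Prop :=
  exists e, forall x t, Phi A e (cpair x t) (g x t).

Definition order_function (h : nat -> nat) : Prop :=
  [/\ computable h,
      (forall n m, n <= m -> h n <= h m) &
      (forall b, exists n, b < h n)].

Definition changes_bounded (g : nat -> nat -> nat) (x b : nat) : Prop :=
  forall n, count (fun t => g x t.+1 != g x t) (iota 0 n) <= b.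

Definition is_limit (g : nat -> nat -> nat) (f : nat -> nat) : Prop :=
  forall x, exists s, forall t, s <= t -> g x t = f x.

Definition omega_ce_by (A : nat -> bool) (f : nat -> nat) : Prop :=
  exists (g : nat -> nat -> nat) (b : nat -> nat),
    [/\ A_computable2 A g, computable b, is_limit g f &
        forall x, changes_bounded g x (b x)].
Definition omega_ce (f : nat -> nat) : Prop := omega_ce_by emptyset f.

Definition W_card_le (e k : nat) : Prop :=
  forall L : seq nat, uniq L -> (forall x, x \in L -> inW e x) -> size L <= k.

Definition BLR_traceable (A : nat -> bool) : Prop :=
  exists h, order_function h /\
    forall f, omega_ce_by A f ->
      exists r, [/\ omega_ce r,
                    (forall n, W_card_le (r n) (h n)) &
                    (forall n, inW (r n) (f n))].

(* binary strings coded by naturals: n <-> binary expansion of n+1 without leading 1 *)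
Fixpoint str_aux (fuel m : nat) : seq bool :=
  match fuel with
  | 0 => [::]
  | fuel'.+1 => if m <= 1 then [::] else rcons (str_aux fuel' m./2) (odd m)
  end.
Definition str_of_nat (n : nat) : seq bool := str_aux n.+1 n.+1.

Definition is_prefix_of (s : seq bool) (Z : nat -> bool) : Prop :=
  s = mkseq Z (size s).

Definition in_open (A : nat -> bool) (e : nat) (Z : nat -> bool) : Prop :=
  exists n, inWA A e n /\ is_prefix_of (str_of_nat n) Z.

(* lambda([W^A_e]^<) <= 2^-m : every finite part of W^A_e generates an open set
   whose measure (computed at any resolution N, as a count of strings of length N)
   is at most 2^-m. *)
Definition measure_le (A : nat -> bool) (e m : nat) : Prop :=
  forall (L : seq nat) (N : nat), (forall n, n \in L -> inWA A e n) ->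
    #|[pred t : N.-tuple bool |
        has (fun n => prefix (str_of_nat n) (tval t)) L]| * 2 ^ m <= 2 ^ N.

Definition Demuth_random_by (A : nat -> bool) (Z : nat -> bool) : Prop :=
  forall f, omega_ce_by A f -> (forall m, measure_le A (f m) m) ->
    exists M, forall m, M <= m -> ~ in_open A (f m) Z.
Definition Demuth_random (Z : nat -> bool) : Prop :=
  Demuth_random_by emptyset Z.

Definition low_for_Demuth_BLR (A : nat -> bool) : Prop :=
  forall Z, Demuth_random Z -> Demuth_random_by A Z.

(* Main.v *)
Require Import Defs.
From mathcomp Require Import all_boot all_order all_algebra.
From mathcomp Require Import zify ring lra.
From Stdlib Require Import Classical ClassicalChoice.
Set Implicit Arguments. Unset Strict Implicit. Unset Printing Implicit Defensive.

(* (i) => (ii): An index of the m-th component of a test relative to A is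
   omega-c.e. by A, but a component need not be captured by finitely many values.
   Cut its enumeration at the last stage where the measure passes a multiple of
   2^-q; for fixed q this stage is again omega-c.e. by A, and the difference of the
   stages for two consecutive precisions is a clopen set of small measure. The n-th
   piece collects these differences for the first a(n) components, with a(n) and the
   precision so large, compared with the bound h(n) of a trace, that any h(n) sets
   of the same measure form together the n-th component of a plain Demuth test. A
   set in infinitely many components of the original test is in infinitely many
   pieces, hence fails the test obtained by tracing the pieces.

   (ii) => (i): Let B_{n,k} be independent clopen sets of measure 2^-n. For f
   omega-c.e. by A, the sets B_{n,f(n)} form a test relative to A, so no Demuth random
   set is in infinitely many of them. Hence the attempt to build such a set by finite
   extension, banning a tail of one more Demuth test at each step while keeping
   positive measure, gets stuck: there are a string s and a tail U of a Demuth test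
   with [s] \ U of measure at least 2^-d such that, for almost all n, U covers almost
   all of [s] /\ B_{n,f(n)}. The k for which finitely many levels of U cover
   [s] /\ B_{n,k} up to 2^-(2n+d+3) form a trace of f, which has at most 4^n elements:
   by independence 4^n of the B_{n,k} miss only a set of measure (1 - 2^-n)^(4^n). *)

(** * Pairing and evaluation *)

(** [cnext] runs through the pairs along antidiagonals, in the order of their Cantor codes, so
    iterating it from (0, 0) inverts [cpair]. *)
Lemma cpair_next p : cpair (cnext p).1 (cnext p).2 = (cpair p.1 p.2).+1.
Proof.
case: p => [[|x] y] /=; rewrite /cpair /cnext /=.
  rewrite add0n addn0 addn0.
  have -> : y.+1 * y.+2 = y.+1 * 2 + y * y.+1 by lia.
  by rewrite divnMDl //; lia.
by rewrite (_ : x + y.+1 = x.+1 + y) ?addnS // addSn.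
Qed.

Lemma cunpairK n : cpair (cunpair n).1 (cunpair n).2 = n.
Proof. by elim: n => [//|n IH]; rewrite /cunpair iterS cpair_next IH. Qed.

Lemma cpairK x y : cunpair (cpair x y) = (x, y).
Proof.
move: {-2}(cpair x y) (erefl (cpair x y)) => n.
elim: n x y => [|n IH] x y E.
  suff: x + y = 0 by case: x y {E} => [|x] [|y].
  move: E; rewrite /cpair; case: (x + y) => [//|s] /esym/eqP; rewrite addn_eq0 => /andP[/eqP H _].
  have : s.+1 * s.+2 = s.+1 * 2 + s * s.+1 by lia.
  by move=> H2; rewrite H2 divnMDl // in H; lia.
(* A pair with positive code has a predecessor under [cnext]: one step back on its antidiagonal, or
   the end of the previous antidiagonal when [y = 0]. *)
have [p Ep] : exists p, cnext p = (x, y).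
  case: y x E => [|y] x E; last by exists (x.+1, y).
  by case: x E => [|x] E; [|exists (0, x)].
rewrite /cunpair iterS -/(cunpair n) (IH p.1 p.2); first by rewrite -surjective_pairing.
have := cpair_next p; rewrite Ep /= -E => H.
by case: H.
Qed.

Lemma leq_cpair_sum x y : x + y <= cpair x y.
Proof.
rewrite /cpair; apply: leq_trans (leq_addr _ _).
case: (x + y) => // s; rewrite leq_divRL //; nia.
Qed.

Lemma leq_cpair x y : (x <= cpair x y) * (y <= cpair x y).
Proof. have := leq_cpair_sum x y; split; lia. Qed.

Lemma leq_cunpair n : ((cunpair n).1 <= n) * ((cunpair n).2 <= n).
Proof. by have := leq_cpair (cunpair n).1 (cunpair n).2; rewrite cunpairK. Qed.

(** The inner fixpoints of [eval] are named, with the recursive calls abstracted to partial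
    functions, so that each loop admits its own induction. *)
Definition rec_loop (F G : nat -> option nat) (y : nat) :=
  fix loop (n : nat) : option nat :=
  match n with
  | 0 => F y
  | i.+1 => match loop i with
            | Some r => G (cpair i (cpair r y))
            | None => None
            end
  end.

Definition mu_loop (F : nat -> option nat) (x : nat) :=
  fix search (b i : nat) : option nat :=
  match b with
  | 0 => None
  | b'.+1 => match F (cpair i x) with
             | Some 0 => Some i
             | Some _ => search b' i.+1
             | None => None
             end
  end.

Lemma eval_rec k A f g x : eval k.+1 A (CRec f g) x =
  rec_loop (eval k A f) (eval k A g) (cunpair x).2 (cunpair x).1.
Proof. by []. Qed.

Lemma eval_mu k A f x : eval k.+1 A (CMu f) x = mu_loop (eval k A f) x k 0.
Proof. by []. Qed.

Definition pext (F G : nat -> option nat) := forall x y, F x = Some y -> G x = Some y.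

Lemma rec_loop_ext F G F' G' y n r : pext F F' -> pext G G' ->
  rec_loop F G y n = Some r -> rec_loop F' G' y n = Some r.
Proof.
move=> HF HG; elim: n r => [|n IH] r /=; first exact: HF.
by case E: rec_loop => [a|//] H; rewrite (IH _ E) (HG _ _ H).
Qed.

Lemma mu_loop_ext F F' x b b' i r : pext F F' -> b <= b' ->
  mu_loop F x b i = Some r -> mu_loop F' x b' i = Some r.
Proof.
move=> HF; elim: b b' i => [//|b IH] [//|b'] i Hb /=.
by case E: (F _) => [[|a]|//]; rewrite (HF _ _ E) // => /IH ->.
Qed.

Lemma eval_mono k k' A c : k <= k' -> pext (eval k A c) (eval k' A c).
Proof.
elim: k k' c => [//|k IH] [//|k'] c Hk.
have {}IH c' : pext (eval k A c') (eval k' A c') by apply: IH.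
case: c => // [f g|f g|f g|f] x y.
- rewrite /=; case E: (eval k A f x) => [a|//]; case E2: (eval k A g x) => [b|//].
  by rewrite (IH _ _ _ E) (IH _ _ _ E2).
- by rewrite /=; case E: (eval k A g x) => [a|//]; rewrite (IH _ _ _ E); apply: IH.
- by rewrite !eval_rec; apply: rec_loop_ext.
- by rewrite !eval_mu; apply: mu_loop_ext.
Qed.

Definition evalsto A c x y := exists k, eval k A c x = Some y.

Lemma evalsto_det A c x y z : evalsto A c x y -> evalsto A c x z -> y = z.
Proof.
case=> k1 H1 [k2 H2]; have := eval_mono (leq_maxl k1 k2) H1.
by rewrite (eval_mono (leq_maxr k1 k2) H2) => -[].
Qed.

Lemma evalsto_zero A x : evalsto A CZero x 0. Proof. by exists 1. Qed.
Lemma evalsto_succ A x : evalsto A CSucc x x.+1. Proof. by exists 1. Qed.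
Lemma evalsto_fst A x : evalsto A CFst x (cunpair x).1. Proof. by exists 1. Qed.
Lemma evalsto_snd A x : evalsto A CSnd x (cunpair x).2. Proof. by exists 1. Qed.
Lemma evalsto_oracle A x : evalsto A COracle x (A x). Proof. by exists 1. Qed.

Lemma evalsto_pair A f g x a b : evalsto A f x a -> evalsto A g x b ->
  evalsto A (CPair f g) x (cpair a b).
Proof.
move=> [k1 H1] [k2 H2]; exists (maxn k1 k2).+1 => /=.
by rewrite (eval_mono (leq_maxl k1 k2) H1) (eval_mono (leq_maxr k1 k2) H2).
Qed.

Lemma evalsto_comp A f g x a b : evalsto A g x a -> evalsto A f a b ->
  evalsto A (CComp f g) x b.
Proof.
move=> [k1 H1] [k2 H2]; exists (maxn k1 k2).+1 => /=.
by rewrite (eval_mono (leq_maxl k1 k2) H1) (eval_mono (leq_maxr k1 k2) H2).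
Qed.

Lemma evalsto_rec0 A f g y b : evalsto A f y b ->
  evalsto A (CRec f g) (cpair 0 y) b.
Proof. by move=> [k H]; exists k.+1; rewrite eval_rec cpairK. Qed.

Lemma evalsto_recS A f g n y a b : evalsto A (CRec f g) (cpair n y) a ->
  evalsto A g (cpair n (cpair a y)) b -> evalsto A (CRec f g) (cpair n.+1 y) b.
Proof.
move=> [[//|k1] H1] [k2 H2]; exists (maxn k1 k2).+1; rewrite eval_rec cpairK /=.
rewrite eval_rec cpairK /= in H1.
rewrite (rec_loop_ext (eval_mono (leq_maxl k1 k2)) (eval_mono (leq_maxl k1 k2)) H1).
by rewrite (eval_mono (leq_maxr k1 k2) H2).
Qed.

Lemma evalsto_mu A f x i : evalsto A f (cpair i x) 0 ->
  (forall j, j < i -> exists v, evalsto A f (cpair j x) v.+1) ->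
  evalsto A (CMu f) x i.
Proof.
move=> [k0 H0] Hlt.
(* The finitely many evaluations receive a common fuel. *)
have [k [Hk Hb]] : exists k, eval k A f (cpair i x) = Some 0 /\
    forall j, j < i -> exists v, eval k A f (cpair j x) = Some v.+1.
  elim: {1 3}i Hlt => [|m IH] Hlt; first by exists k0.
  have [j Hj|k [Hk Hb]] := IH; first by apply: Hlt; apply: ltnW.
  have [v [k2 H2]] := Hlt m (ltnSn m).
  exists (maxn k k2); split; first exact: (eval_mono (leq_maxl _ _) Hk).
  move=> j; rewrite ltnS leq_eqVlt => /orP[/eqP ->|Hj].
    by exists v; apply: (eval_mono (leq_maxr _ _) H2).
  by have [w Hw] := Hb j Hj; exists w; apply: (eval_mono (leq_maxl _ _) Hw).
(* The fuel also bounds the number of values searched, hence the [i.+1]. *)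
exists (maxn k i.+1).+1; rewrite eval_mu.
set K := maxn k i.+1.
have {}Hk := eval_mono (leq_maxl k i.+1) Hk; rewrite -/K in Hk.
have {}Hb j : j < i -> exists v, eval K A f (cpair j x) = Some v.+1.
  by move=> /Hb[v Hv]; exists v; apply: (eval_mono (leq_maxl _ _) Hv).
have Hg : forall d j b, d + j = i -> d < b -> mu_loop (eval K A f) x b j = Some i.
  elim=> [|d IH] j [//|b] /= Hd Hlb; first by rewrite add0n in Hd; rewrite Hd Hk.
  have [|v ->] := Hb j; first by lia.
  by apply: IH; lia.
by apply: (Hg i); [lia|rewrite /K; lia].
Qed.


Lemma mu_loopI F x b i r : mu_loop F x b i = Some r ->
  [/\ i <= r, F (cpair r x) = Some 0 &
      forall j, i <= j < r -> exists v, F (cpair j x) = Some v.+1].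
Proof.
elim: b i => [//|b IH] i /=; case E: (F _) => [[|a]|//].
  by move=> [<-]; split => // j; lia.
move=> /IH[H1 H2 H3]; split => //; first by lia.
move=> j; case: (ltngtP i j) => // Hij Hj; first by apply: H3; lia.
by exists a; rewrite -Hij.
Qed.

Lemma evalsto_fst_pair A a b : evalsto A CFst (cpair a b) a.
Proof. by have := evalsto_fst A (cpair a b); rewrite cpairK. Qed.

Lemma evalsto_snd_pair A a b : evalsto A CSnd (cpair a b) b.
Proof. by have := evalsto_snd A (cpair a b); rewrite cpairK. Qed.

(** * Functions computable between coded types *)

(** Injectivity is enough to speak of computable functions; codings onto [nat] are singled out later
    as [EncBij]. *)
Class Enc (T : Type) := { enc : T -> nat; enc_inj : injective enc }.

#[global] Instance Enc_nat : Enc nat := {| enc := id; enc_inj := @inj_id nat |}.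

Lemma nat_of_bool_inj : injective nat_of_bool. Proof. by case; case. Qed.
#[global] Instance Enc_bool : Enc bool := {| enc_inj := nat_of_bool_inj |}.

Section EncProd.
Context (T U : Type) {ET : Enc T} {EU : Enc U}.
Definition enc_prod (p : T * U) := cpair (enc p.1) (enc p.2).
Lemma enc_prod_inj : injective enc_prod.
Proof.
move=> [a b] [c d] /(congr1 cunpair); rewrite /enc_prod !cpairK /= => -[].
by move=> H1 H2; rewrite (enc_inj H1) (enc_inj H2).
Qed.
#[global] Instance Enc_prod : Enc (T * U) := {| enc_inj := enc_prod_inj |}.
End EncProd.

Section EncSeq.
Context (T : Type) {ET : Enc T}.
(** The successor keeps nonempty lists apart from the empty one and makes the code an upper bound
    for the length, on which [comp_foldr] relies. *)
Fixpoint enc_seq (s : seq T) :=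
  if s is a :: s' then (cpair (enc a) (enc_seq s')).+1 else 0.
Lemma enc_seq_inj : injective enc_seq.
Proof.
elim=> [|a s IH] [|b t] //= [] /(congr1 cunpair); rewrite !cpairK => -[].
by move=> H1 H2; rewrite (enc_inj H1) (IH _ H2).
Qed.
#[global] Instance Enc_seq : Enc (seq T) := {| enc_inj := enc_seq_inj |}.
Lemma size_enc_seq s : size s <= enc s.
Proof.
by elim: s => //= a s IH; rewrite ltnS; apply: leq_trans IH _; rewrite leq_cpair.
Qed.
End EncSeq.

(** Nothing is asked of the program on numbers that are not codes. *)
Definition Acomputable (A : nat -> bool) (T U : Type) {ET : Enc T} {EU : Enc U} (f : T -> U) :=
  exists c, forall x, evalsto A c (enc x) (enc (f x)).

Ltac comp_eta :=
  lazymatch goal with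
  | |- @Acomputable ?A ?T ?U ?ET ?EU ?f => change (@Acomputable A T U ET EU (fun x => f x)); cbn beta
  end.

Lemma iter_behead (T : Type) n (s : seq T) : iter n behead s = drop n s.
Proof. by elim: n => [|n IH]; rewrite ?drop0 // iterS IH -drop1 drop_drop add1n. Qed.

Section Acomputable.
Context (A : nat -> bool).

Section Base.
Context (X Y T U V : Type) {EX : Enc X} {EY : Enc Y} {ET : Enc T} {EU : Enc U} {EV : Enc V}.

Lemma comp_ext (f g : X -> T) : f =1 g -> Acomputable A f -> Acomputable A g.
Proof. by move=> E [c H]; exists c => x; rewrite -E. Qed.

(** The same program serves both functions: a change of type that keeps the code is free. *)
Lemma comp_enc (f : X -> T) (g : X -> U) :
  Acomputable A f -> (forall x, enc (f x) = enc (g x)) -> Acomputable A g.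
Proof. by move=> [c H] E; exists c => x; rewrite -E. Qed.

Lemma comp_comp (h : T -> U) (f : X -> T) : Acomputable A h -> Acomputable A f -> Acomputable A (fun x => h (f x)).
Proof. by move=> [c H] [d G]; exists (CComp c d) => x; apply: evalsto_comp (G x) (H _). Qed.

Lemma comp_pair (f : X -> T) (g : X -> U) :
  Acomputable A f -> Acomputable A g -> Acomputable A (fun x => (f x, g x)).
Proof. by move=> [c H] [d G]; exists (CPair c d) => x; apply: evalsto_pair. Qed.

Lemma comp_fst (f : X -> T * U) : Acomputable A f -> Acomputable A (fun x => (f x).1).
Proof.
move=> [c H]; exists (CComp CFst c) => x; apply: evalsto_comp (H x) _.
exact: evalsto_fst_pair.
Qed.

Lemma comp_snd (f : X -> T * U) : Acomputable A f -> Acomputable A (fun x => (f x).2).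
Proof.
move=> [c H]; exists (CComp CSnd c) => x; apply: evalsto_comp (H x) _.
exact: evalsto_snd_pair.
Qed.

Lemma comp_id : Acomputable A (fun x : X => x).
Proof.
exists (CPair CFst CSnd) => x.
by rewrite -{2}(cunpairK (enc x)); apply: evalsto_pair; [apply: evalsto_fst|apply: evalsto_snd].
Qed.

Fixpoint const_code n := if n is m.+1 then CComp CSucc (const_code m) else CZero.
Lemma evalsto_const n x : evalsto A (const_code n) x n.
Proof.
elim: n => [|n IH]; first exact: evalsto_zero.
exact: evalsto_comp IH (evalsto_succ _ _).
Qed.

Lemma comp_const (a : T) : Acomputable A (fun _ : X => a).
Proof. by exists (const_code (enc a)) => x; apply: evalsto_const. Qed.

Lemma comp_succ (f : X -> nat) : Acomputable A f -> Acomputable A (fun x => (f x).+1).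
Proof. by move=> [c H]; exists (CComp CSucc c) => x; apply: evalsto_comp (H x) (evalsto_succ _ _). Qed.

Lemma comp_oracle (f : X -> nat) : Acomputable A f -> Acomputable A (fun x => A (f x)).
Proof. by move=> [c H]; exists (CComp COracle c) => x; apply: evalsto_comp (H x) (evalsto_oracle _ _). Qed.

Fixpoint nrec (g : nat -> U -> U) (z : U) n := if n is m.+1 then g m (nrec g z m) else z.

Lemma comp_nrec (g : X -> nat -> U -> U) (z : X -> U) (n : X -> nat) :
  Acomputable A (fun q : nat * (U * X) => g q.2.2 q.1 q.2.1) -> Acomputable A z -> Acomputable A n ->
  Acomputable A (fun x => nrec (g x) (z x) (n x)).
Proof.
move=> [c H] [d G] [e K]; have [i I] := comp_id.
exists (CComp (CRec d c) (CPair e i)) => x.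
apply: evalsto_comp; first exact: evalsto_pair (K x) (I x).
elim: (n x) => [|m IH]; first exact: evalsto_rec0.
exact: evalsto_recS IH (H (m, (_, x))).
Qed.

End Base.

Section Casts.
Context (X T : Type) {EX : Enc X} {ET : Enc T}.

Lemma comp_toenc (f : X -> T) : Acomputable A f -> Acomputable A (fun x => enc (f x)).
Proof. by move=> F; apply: comp_enc F _. Qed.

Lemma comp_nat_of_bool (f : X -> bool) : Acomputable A f -> Acomputable A (fun x => nat_of_bool (f x)).
Proof. by move=> F; apply: comp_enc F _. Qed.

Lemma comp_cunpair (f : X -> nat) : Acomputable A f -> Acomputable A (fun x => cunpair (f x)).
Proof. by move=> F; apply: comp_enc F _ => x; rewrite /enc /= /enc_prod cunpairK. Qed.

Lemma comp_cpair (f g : X -> nat) : Acomputable A f -> Acomputable A g -> Acomputable A (fun x => cpair (f x) (g x)).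
Proof. by move=> F G; apply: comp_enc (comp_pair F G) _. Qed.

End Casts.

Ltac comp_proj := repeat (comp_eta; lazymatch goal with
  | |- Acomputable _ (fun x => x) => exact: comp_id
  | |- Acomputable _ (fun _ => ?c) => exact: comp_const
  | |- Acomputable _ (fun x => (@?f x, @?g x)) => apply: comp_pair
  | |- Acomputable _ (fun x => fst _) => apply: comp_fst
  | |- Acomputable _ (fun x => snd _) => apply: comp_snd
  end).

Section Ops.
Context (X T U : Type) {EX : Enc X} {ET : Enc T} {EU : Enc U}.

Lemma comp_if (b : X -> bool) (f g : X -> T) : Acomputable A b -> Acomputable A f -> Acomputable A g ->
  Acomputable A (fun x => if b x then f x else g x).
Proof.
move=> B F G.
apply: (comp_ext (f := fun x => nrec (fun _ _ => f x) (g x) (b x))) => [x|].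
  by case: (b x).
apply: comp_nrec => //.
by apply: comp_comp F _; comp_proj.
Qed.

Lemma comp_pred (f : X -> nat) : Acomputable A f -> Acomputable A (fun x => (f x).-1).
Proof.
move=> F; apply: (comp_ext (f := fun x => nrec (fun i _ => i) 0 (f x))) => [x|].
  by case: (f x).
apply: comp_nrec => //; last exact: comp_const.
by apply: comp_fst; apply: comp_id.
Qed.

Lemma comp_iter (f : X -> T -> T) (z : X -> T) (n : X -> nat) :
  Acomputable A (fun q : X * T => f q.1 q.2) -> Acomputable A z -> Acomputable A n ->
  Acomputable A (fun x => iter (n x) (f x) (z x)).
Proof.
move=> F Z N.
apply: (comp_ext (f := fun x => nrec (fun _ a => f x a) (z x) (n x))) => [x|].
  by elim: (n x) => //= m ->.
apply: comp_nrec => //.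
apply: (comp_comp F (f := fun q : nat * (T * X) => (q.2.2, q.2.1))).
by comp_proj.
Qed.

End Ops.

Lemma comp_add (X : Type) {EX : Enc X} (f g : X -> nat) : Acomputable A f -> Acomputable A g -> Acomputable A (fun x => f x + g x).
Proof.
move=> F G; apply: (comp_ext (f := fun x => iter (f x) succn (g x))) => [x|].
  by elim: (f x) => //= m ->.
by apply: comp_iter => //; apply: comp_succ; comp_proj.
Qed.

Lemma comp_mul (X : Type) {EX : Enc X} (f g : X -> nat) : Acomputable A f -> Acomputable A g -> Acomputable A (fun x => f x * g x).
Proof.
move=> F G; apply: (comp_ext (f := fun x => iter (f x) (addn (g x)) 0)) => [x|].
  by elim: (f x) => //= m ->.
apply: comp_iter => //; last exact: comp_const.
by apply: comp_add; [apply: comp_comp G _|]; comp_proj.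
Qed.

Lemma comp_exp (X : Type) {EX : Enc X} (f g : X -> nat) : Acomputable A f -> Acomputable A g -> Acomputable A (fun x => f x ^ g x).
Proof.
move=> F G; apply: (comp_ext (f := fun x => iter (g x) (muln (f x)) 1)) => [x|].
  by elim: (g x) => //= m ->; rewrite expnS.
apply: comp_iter => //; last exact: comp_const.
by apply: comp_mul; [apply: comp_comp F _|]; comp_proj.
Qed.

Lemma comp_sub (X : Type) {EX : Enc X} (f g : X -> nat) : Acomputable A f -> Acomputable A g -> Acomputable A (fun x => f x - g x).
Proof.
move=> F G; apply: (comp_ext (f := fun x => iter (g x) predn (f x))) => [x|].
  by elim: (g x) => /= [|m ->]; rewrite ?subn0 ?subnS.
by apply: comp_iter => //; apply: comp_pred; comp_proj.
Qed.

Lemma comp_isz (X : Type) {EX : Enc X} (f : X -> nat) : Acomputable A f -> Acomputable A (fun x => f x == 0).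
Proof.
move=> F; apply: (comp_ext (f := fun x => nrec (fun _ _ => false) true (f x))) => [x|].
  by case: (f x).
by apply: comp_nrec => //; apply: comp_const.
Qed.

Lemma comp_leq (X : Type) {EX : Enc X} (f g : X -> nat) : Acomputable A f -> Acomputable A g -> Acomputable A (fun x => f x <= g x).
Proof. by move=> F G; apply: comp_isz; apply: comp_sub. Qed.

Lemma comp_neg (X : Type) {EX : Enc X} (b : X -> bool) : Acomputable A b -> Acomputable A (fun x => ~~ b x).
Proof.
move=> B; apply: (comp_ext (f := fun x => if b x then false else true)) => //.
by apply: comp_if => //; apply: comp_const.
Qed.

Lemma comp_and (X : Type) {EX : Enc X} (b c : X -> bool) : Acomputable A b -> Acomputable A c -> Acomputable A (fun x => b x && c x).
Proof. by move=> B C; apply: comp_if => //; apply: comp_const. Qed.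

Lemma comp_or (X : Type) {EX : Enc X} (b c : X -> bool) : Acomputable A b -> Acomputable A c -> Acomputable A (fun x => b x || c x).
Proof. by move=> B C; apply: comp_if => //; apply: comp_const. Qed.


Lemma comp_eq (X : Type) (T : eqType) {EX : Enc X} {ET : Enc T} (f g : X -> T) :
  Acomputable A f -> Acomputable A g -> Acomputable A (fun x => f x == g x).
Proof.
move=> F G; apply: (comp_ext (f := fun x => (enc (f x) <= enc (g x)) && (enc (g x) <= enc (f x)))).
  by move=> x; rewrite -eqn_leq (inj_eq enc_inj).
by apply: comp_and; apply: comp_leq; apply: comp_toenc.
Qed.

Lemma comp_cons (X T : Type) {EX : Enc X} {ET : Enc T} (f : X -> T) (s : X -> seq T) : Acomputable A f -> Acomputable A s ->
  Acomputable A (fun x => f x :: s x).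
Proof. by move=> F S; apply: comp_enc (comp_succ (comp_toenc (comp_pair F S))) _. Qed.

Lemma comp_behead (X T : Type) {EX : Enc X} {ET : Enc T} (s : X -> seq T) : Acomputable A s -> Acomputable A (fun x => behead (s x)).
Proof.
move=> S; apply: comp_enc (comp_snd (comp_cunpair (comp_pred (comp_toenc S)))) _ => x /=.
by case: (s x) => //= a l; rewrite cpairK.
Qed.

(* Running the branch [F] as the body of a recursion of length at most one
   keeps it from being evaluated on the empty list, where it could diverge. *)
Lemma comp_seqcase (X T U : Type) {EX : Enc X} {ET : Enc T} {EU : Enc U} (s : X -> seq T) (z : X -> U) (F : X -> T -> seq T -> U) :
  Acomputable A s -> Acomputable A z -> Acomputable A (fun q : X * (T * seq T) => F q.1 q.2.1 q.2.2) ->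
  Acomputable A (fun x => if s x is a :: l then F x a l else z x).
Proof.
move=> S [d Z] [c H].
have [n N] : Acomputable A (fun x => nat_of_bool (~~ (enc (s x) == 0))).
  by apply: comp_nat_of_bool; apply: comp_neg; apply: comp_isz; apply: comp_toenc.
have [m M] : Acomputable A (fun x => (x, (enc (s x)).-1)).
  by apply: comp_pair; [exact: comp_id|apply: comp_pred; apply: comp_toenc].
have [i I] : Acomputable A (fun x : X => x) by exact: comp_id.
exists (CComp (CRec d (CComp c (CComp m (CComp CSnd CSnd)))) (CPair n i)) => x.
apply: evalsto_comp.
  exact: evalsto_pair (N x) (I x).
rewrite {1}/enc /=.
have := M x; case: (s x) => [|a l] /= Mx; first exact/evalsto_rec0/Z.
apply: evalsto_recS; first exact/evalsto_rec0/Z.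
apply: evalsto_comp (H (x, (a, l))).
apply: evalsto_comp Mx; apply: evalsto_comp; exact: evalsto_snd_pair.
Qed.

(** The fold becomes a primitive recursion whose length is the code of the list, a bound for its
    size. Step [i] looks at a suffix that grows with [i]; as long as the suffix is empty the
    accumulator is left alone. *)
Lemma comp_foldr (X T U : Type) {EX : Enc X} {ET : Enc T} {EU : Enc U} (F : X -> T -> U -> U) (z : X -> U) (s : X -> seq T) :
  Acomputable A (fun q : X * (T * U) => F q.1 q.2.1 q.2.2) -> Acomputable A z -> Acomputable A s ->
  Acomputable A (fun x => foldr (F x) (z x) (s x)).
Proof.
move=> HF Z S.
apply: (comp_ext (f := fun x => nrec (fun i acc =>
   if iter (enc (s x) - i.+1) behead (s x) is a :: l then F x a acc else acc) (z x) (enc (s x)))).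
  move=> x; set n := enc (s x).
  have Hk : forall k, k <= n -> nrec (fun i acc =>
     if iter (n - i.+1) behead (s x) is a :: l then F x a acc else acc) (z x) k =
     foldr (F x) (z x) (iter (n - k) behead (s x)).
    elim=> [|k IH] Hk /=.
      rewrite subn0 (_ : iter n behead (s x) = [::]) //.
      by rewrite iter_behead drop_oversize // size_enc_seq.
    rewrite {}IH; last by apply: ltnW.
    have -> : n - k = (n - k.+1).+1 by lia.
    by rewrite iterS; case: (iter _ _ _).
  by rewrite Hk // subnn.
apply: comp_nrec => //.
apply: comp_seqcase.
- apply: comp_iter; first by apply: comp_behead; comp_proj.
    by apply: comp_comp S _; comp_proj.
  apply: comp_sub; last by apply: comp_succ; comp_proj.
  apply: comp_toenc; apply: comp_comp S _.
  by comp_proj.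
- by comp_proj.
- apply: (comp_comp HF (f := fun q : (nat * (U * X)) * (T * seq T) => (q.1.2.2, (q.2.1, q.1.2.1)))).
  by comp_proj.
Qed.


End Acomputable.

(* Computability follows the syntax of a function; [comp_user] and its successors
   are hooks, redefined as further operations become available. *)
Ltac comp_user := fail.
Ltac comp_step :=
  comp_eta;
  lazymatch goal with
  | |- Acomputable _ (fun x => x) => exact: comp_id
  | |- Acomputable _ (fun _ => ?c) => exact: comp_const
  | H : Acomputable ?A ?h |- Acomputable ?A ?h => exact: H
  | |- Acomputable _ (fun x => (@?f x, @?g x)) => apply: comp_pair
  | |- Acomputable _ (fun x => fst _) => apply: comp_fst
  | |- Acomputable _ (fun x => snd _) => apply: comp_snd
  | |- Acomputable _ (fun x => S _) => apply: comp_succ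
  | |- Acomputable _ (fun x => predn _) => apply: comp_pred
  | |- Acomputable _ (fun x => addn _ _) => apply: comp_add
  | |- Acomputable _ (fun x => subn _ _) => apply: comp_sub
  | |- Acomputable _ (fun x => muln _ _) => apply: comp_mul
  | |- Acomputable _ (fun x => expn _ _) => apply: comp_exp
  | |- Acomputable _ (fun x => leq _ _) => apply: comp_leq
  | |- Acomputable _ (fun x => nat_of_bool _) => apply: comp_nat_of_bool
  | |- Acomputable _ (fun x => cunpair _) => apply: comp_cunpair
  | |- Acomputable _ (fun x => cpair _ _) => apply: comp_cpair
  | |- Acomputable _ (fun x => @enc _ _ _) => apply: comp_toenc
  | |- Acomputable _ (fun x => negb _) => apply: comp_neg
  | |- Acomputable _ (fun x => andb _ _) => apply: comp_and
  | |- Acomputable _ (fun x => orb _ _) => apply: comp_or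
  | |- Acomputable _ (fun x => if _ then _ else _) => apply: comp_if
  | |- Acomputable _ (fun x => eq_op _ _) => apply: comp_eq
  | |- Acomputable _ (fun x => cons _ _) => apply: comp_cons
  | |- Acomputable _ (fun x => behead _) => apply: comp_behead
  | |- Acomputable _ (fun x => iter _ _ _) => apply: comp_iter
  | |- Acomputable _ (fun x => nrec _ _ _) => apply: comp_nrec
  | |- Acomputable _ (fun x => foldr _ _ _) => apply: comp_foldr
  | H : Acomputable ?A ?h |- Acomputable ?A (fun x => ?h _) => apply: (comp_comp H)
  | |- _ => comp_user
  end.
Ltac comp_tac := repeat comp_step.

Section More.
Context (A : nat -> bool).

Section L.
Context (X T U : Type) {EX : Enc X} {ET : Enc T} {EU : Enc U}.

Lemma comp_cat (s t : X -> seq T) : Acomputable A s -> Acomputable A t -> Acomputable A (fun x => s x ++ t x).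
Proof.
move=> S T'; apply: (comp_ext (f := fun x => foldr cons (t x) (s x))) => [x|].
  by elim: (s x) => //= a l ->.
by comp_tac.
Qed.

End L.

Section L2.
Context (X T U : Type) {EX : Enc X} {ET : Enc T} {EU : Enc U}.

Lemma comp_map (F : X -> T -> U) (s : X -> seq T) :
  Acomputable A (fun q : X * T => F q.1 q.2) -> Acomputable A s -> Acomputable A (fun x => map (F x) (s x)).
Proof.
move=> HF S; apply: (comp_ext (f := fun x => foldr (fun a l => F x a :: l) [::] (s x))) => [x|].
  by elim: (s x) => //= a l ->.
comp_tac.
by apply: (comp_comp HF (f := fun q : X * (T * seq U) => (q.1, q.2.1))); comp_tac.
Qed.

Lemma comp_filter (F : X -> T -> bool) (s : X -> seq T) :
  Acomputable A (fun q : X * T => F q.1 q.2) -> Acomputable A s -> Acomputable A (fun x => filter (F x) (s x)).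
Proof.
move=> HF S; apply: (comp_ext (f := fun x => foldr (fun a l => if F x a then a :: l else l) [::] (s x))) => [x|].
  by elim: (s x) => //= a l ->.
comp_tac.
by apply: (comp_comp HF (f := fun q : X * (T * seq T) => (q.1, q.2.1))); comp_tac.
Qed.

Lemma comp_has (F : X -> T -> bool) (s : X -> seq T) :
  Acomputable A (fun q : X * T => F q.1 q.2) -> Acomputable A s -> Acomputable A (fun x => has (F x) (s x)).
Proof.
move=> HF S; apply: (comp_ext (f := fun x => foldr (fun a l => F x a || l) false (s x))) => [x|].
  by elim: (s x) => //= a l ->.
comp_tac.
by apply: (comp_comp HF (f := fun q : X * (T * bool) => (q.1, q.2.1))); comp_tac.
Qed.

Lemma comp_all (F : X -> T -> bool) (s : X -> seq T) :
  Acomputable A (fun q : X * T => F q.1 q.2) -> Acomputable A s -> Acomputable A (fun x => all (F x) (s x)).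
Proof.
move=> HF S; apply: (comp_ext (f := fun x => foldr (fun a l => F x a && l) true (s x))) => [x|].
  by elim: (s x) => //= a l ->.
comp_tac.
by apply: (comp_comp HF (f := fun q : X * (T * bool) => (q.1, q.2.1))); comp_tac.
Qed.

Lemma comp_size (s : X -> seq T) : Acomputable A s -> Acomputable A (fun x => size (s x)).
Proof.
move=> S; apply: (comp_ext (f := fun x => foldr (fun a l => l.+1) 0 (s x))) => [x|].
  by elim: (s x) => //= a l ->.
by comp_tac.
Qed.

Lemma comp_count (F : X -> T -> bool) (s : X -> seq T) :
  Acomputable A (fun q : X * T => F q.1 q.2) -> Acomputable A s -> Acomputable A (fun x => count (F x) (s x)).
Proof.
move=> HF S; apply: (comp_ext (f := fun x => size (filter (F x) (s x)))) => [x|].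
  by rewrite size_filter.
by apply: comp_size; apply: comp_filter.
Qed.

Lemma comp_sumn (s : X -> seq nat) : Acomputable A s -> Acomputable A (fun x => sumn (s x)).
Proof. by move=> S; rewrite /sumn; comp_tac. Qed.

Lemma comp_iota (m n : X -> nat) : Acomputable A m -> Acomputable A n -> Acomputable A (fun x => iota (m x) (n x)).
Proof.
move=> M N; apply: (comp_ext (f := fun x => nrec (fun i l => l ++ [:: m x + i]) [::] (n x))) => [x|].
  by elim: (n x) => [//|k IH]; rewrite -[in RHS]addn1 iotaD -IH.
comp_tac.
by apply: comp_cat; comp_tac.
Qed.

Lemma comp_nth (d : X -> T) (s : X -> seq T) (n : X -> nat) :
  Acomputable A d -> Acomputable A s -> Acomputable A n -> Acomputable A (fun x => nth (d x) (s x) (n x)).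
Proof.
move=> D S N.
apply: (comp_ext (f := fun x => if iter (n x) behead (s x) is a :: l then a else d x)).
  move=> x; rewrite iter_behead; case: (ltnP (n x) (size (s x))) => H.
    by rewrite (drop_nth (d x) H).
  by rewrite drop_oversize // nth_default.
by apply: comp_seqcase; comp_tac.
Qed.

End L2.

Lemma comp_mem (X : Type) (T : eqType) {EX : Enc X} {ET : Enc T} (a : X -> T) (s : X -> seq T) :
  Acomputable A a -> Acomputable A s -> Acomputable A (fun x => a x \in s x).
Proof.
move=> HA S; apply: (comp_ext (f := fun x => has (fun b => b == a x) (s x))) => [x|].
  by rewrite has_pred1.
by apply: comp_has; comp_tac.
Qed.

Section N.
Context (X : Type) {EX : Enc X}.
Implicit Types f g : X -> nat.

(** For positive [b] the quotient is the number of positive multiples of [b] up to [a], which turns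
    division into a bounded count. *)
Lemma divn_count a b : a %/ b = if b == 0 then 0 else count (fun j => j.+1 * b <= a) (iota 0 a).
Proof.
case: b => [|b] /=; first by rewrite divn0.
rewrite (eq_in_count (a2 := fun j => j < a %/ b.+1)); last by move=> j _; rewrite -leq_divRL.
have : a %/ b.+1 <= a by apply: leq_div.
move: (a %/ b.+1) => k Hk; rewrite -(subnK Hk) addnC iotaD count_cat.
rewrite (_ : count _ (iota 0 k) = k); last first.
  by rewrite -[RHS](size_iota 0 k); apply/eqP; rewrite -all_count; apply/allP => j; rewrite mem_iota.
rewrite (_ : count _ _ = 0) ?addn0 //.
by apply/eqP; rewrite eqn0Ngt -has_count; apply/hasPn => j; rewrite mem_iota; lia.
Qed.

Lemma comp_div f g : Acomputable A f -> Acomputable A g -> Acomputable A (fun x => f x %/ g x).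
Proof.
move=> F G.
apply: (comp_ext (f := fun x => if g x == 0 then 0 else count (fun j => j.+1 * g x <= f x) (iota 0 (f x)))) => [x|].
  by rewrite -divn_count.
by comp_tac; apply: comp_count; [|apply: comp_iota]; comp_tac.
Qed.

Lemma comp_mod f g : Acomputable A f -> Acomputable A g -> Acomputable A (fun x => f x %% g x).
Proof.
move=> F G; apply: (comp_ext (f := fun x => f x - f x %/ g x * g x)) => [x|].
  by rewrite {1}(divn_eq (f x) (g x)) addKn.
by comp_tac; apply: comp_div.
Qed.

Lemma comp_half f : Acomputable A f -> Acomputable A (fun x => (f x)./2).
Proof.
move=> F; apply: (comp_ext (f := fun x => f x %/ 2)) => [x|]; first by rewrite divn2.
by apply: comp_div; comp_tac.
Qed.

Lemma comp_odd f : Acomputable A f -> Acomputable A (fun x => odd (f x)).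
Proof.
move=> F; apply: (comp_ext (f := fun x => f x %% 2 == 1)) => [x|]; first by rewrite modn2 eqb1.
by comp_tac; apply: comp_mod; comp_tac.
Qed.

End N.
End More.

Ltac comp_user3 := fail.
Ltac comp_user ::=
  lazymatch goal with
  | |- Acomputable _ (fun x => cat _ _) => apply: comp_cat
  | |- Acomputable _ (fun x => map _ _) => apply: comp_map
  | |- Acomputable _ (fun x => filter _ _) => apply: comp_filter
  | |- Acomputable _ (fun x => has _ _) => apply: comp_has
  | |- Acomputable _ (fun x => all _ _) => apply: comp_all
  | |- Acomputable _ (fun x => count _ _) => apply: comp_count
  | |- Acomputable _ (fun x => size _) => apply: comp_size
  | |- Acomputable _ (fun x => sumn _) => apply: comp_sumn
  | |- Acomputable _ (fun x => iota _ _) => apply: comp_iota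
  | |- Acomputable _ (fun x => nth _ _ _) => apply: comp_nth
  | |- Acomputable _ (fun x => in_mem _ (mem _)) => apply: comp_mem
  | |- Acomputable _ (fun x => divn _ _) => apply: comp_div
  | |- Acomputable _ (fun x => modn _ _) => apply: comp_mod
  | |- Acomputable _ (fun x => half _) => apply: comp_half
  | |- Acomputable _ (fun x => odd _) => apply: comp_odd
  | |- _ => comp_user3
  end.

Section Strings.
Context (A : nat -> bool).

Lemma comp_take (X T : Type) {EX : Enc X} {ET : Enc T} (n : X -> nat) (s : X -> seq T) :
  Acomputable A n -> Acomputable A s -> Acomputable A (fun x => take (n x) (s x)).
Proof.
move=> N S.
apply: (comp_ext (f := fun x =>
  nrec (fun i l => if iter i behead (s x) is a :: _ then l ++ [:: a] else l) [::] (n x))) => [x|].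
  elim: (n x) => [|k /= ->]; first by rewrite take0.
  rewrite iter_behead; case E: (drop k (s x)) => [|a l].
    have H : size (s x) <= k by rewrite -subn_eq0 -size_drop E.
    by rewrite !take_oversize // ltnW.
  have H : k < size (s x) by rewrite ltnNge -subn_eq0 -size_drop E.
  rewrite -addn1 takeD E /= take0 //.
comp_tac.
by apply: comp_seqcase; comp_tac.
Qed.

(** [str_aux] appends a digit after its recursive call; an accumulator turns this into an iteration,
    which stands still once the number is at most 1. *)
Lemma str_auxE fuel m acc : str_aux fuel m ++ acc =
  (iter fuel (fun q : nat * seq bool => if q.1 <= 1 then q else (q.1./2, odd q.1 :: q.2)) (m, acc)).2.
Proof.
elim: fuel m acc => [|k IH] m acc //.
rewrite iterSr /=; case: leqP => Hm /=; last by rewrite -IH cat_rcons.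
by rewrite -IH; case: k {IH} => [|k] //=; rewrite Hm.
Qed.

Lemma comp_str (X : Type) {EX : Enc X} (f : X -> nat) :
  Acomputable A f -> Acomputable A (fun x => str_of_nat (f x)).
Proof.
move=> F; apply: (comp_ext (f := fun x => (iter (f x).+1 (fun q : nat * seq bool =>
   if q.1 <= 1 then q else (q.1./2, odd q.1 :: q.2)) ((f x).+1, [::])).2)) => [x|].
  by rewrite -str_auxE cats0.
by comp_tac.
Qed.

Lemma comp_prefix (X : Type) (T : eqType) {EX : Enc X} {ET : Enc T} (s t : X -> seq T) :
  Acomputable A s -> Acomputable A t -> Acomputable A (fun x => prefix (s x) (t x)).
Proof.
move=> S T'; apply: (comp_ext (f := fun x => take (size (s x)) (t x) == s x)) => [x|].
  by rewrite prefixE.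
by comp_tac; apply: comp_take; comp_tac.
Qed.

End Strings.
Ltac comp_user4 := fail.
Ltac comp_user3 ::=
  lazymatch goal with
  | |- Acomputable _ (fun x => take _ _) => apply: comp_take
  | |- Acomputable _ (fun x => str_of_nat _) => apply: comp_str
  | |- Acomputable _ (fun x => prefix _ _) => apply: comp_prefix
  | |- _ => comp_user4
  end.

(** * Enumeration and universal simulation *)

Fixpoint encode (c : code) : nat :=
  match c with
  | CZero => 0 | CSucc => 1 | CFst => 2 | CSnd => 3 | COracle => 4
  | CPair f g => 9 * cpair (encode f) (encode g) + 5
  | CComp f g => 9 * cpair (encode f) (encode g) + 6
  | CRec f g => 9 * cpair (encode f) (encode g) + 7
  | CMu f => 9 * encode f + 8
  end.

(** The recursive calls concern numbers at most [n %/ 9], so any fuel from [n] on gives the same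
    program. *)
Lemma decode_aux_fuel k k' n : n <= k -> n <= k' -> decode_aux k n = decode_aux k' n.
Proof.
elim: k k' n => [|k IH] [|k'] n; rewrite ?leqn0.
- by [].
- by move=> /eqP -> _ /=.
- by move=> _ /eqP ->.
move=> H1 H2 /=.
have Hm : n %/ 9 <= k /\ n %/ 9 <= k' by lia.
have [L R] := leq_cunpair (n %/ 9).
rewrite !(IH k') //; lia.
Qed.

Lemma decodeE n : decode n =
  let m := n %/ 9 in
  let l := decode (cunpair m).1 in
  let r := decode (cunpair m).2 in
  match n %% 9 with
  | 0 => CZero | 1 => CSucc | 2 => CFst | 3 => CSnd | 4 => COracle
  | 5 => CPair l r | 6 => CComp l r | 7 => CRec l r | _ => CMu (decode m)
  end.
Proof.
rewrite {1}/decode; case: n => [//|n] /=.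
have Hm : n.+1 %/ 9 <= n by lia.
have [L R] := leq_cunpair (n.+1 %/ 9).
by rewrite /decode !(@decode_aux_fuel n _ _ _ (leqnn _)) //; lia.
Qed.

Lemma encodeK c : decode (encode c) = c.
Proof.
have D m i : i < 9 -> (9 * m + i) %/ 9 = m by lia.
have M m i : i < 9 -> (9 * m + i) %% 9 = i by lia.
by elim: c => //= [f IHf g IHg|f IHf g IHg|f IHf g IHg|f IHf];
  rewrite decodeE /= D // M //= ?cpairK /= ?IHf ?IHg.
Qed.

Lemma A_computableP A f : A_computable A f <-> Acomputable A f.
Proof.
split=> [[e H]|[c H]]; first by exists (decode e).
by exists (encode c) => x; rewrite /Phi encodeK; apply: H.
Qed.

Lemma A_computable2P A g :
  A_computable2 A g <-> Acomputable A (fun q : nat * nat => g q.1 q.2).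
Proof.
split=> [[e H]|[c H]].
  by exists (decode e) => -[x t]; apply: H.
by exists (encode c) => x t; rewrite /Phi encodeK; apply: (H (x, t)).
Qed.

(** The empty oracle answers every query by 0. Replacing queries by [CZero] makes a plain
    computation work under every oracle. *)
Fixpoint strip (c : code) : code :=
  match c with
  | COracle => CZero
  | CPair f g => CPair (strip f) (strip g)
  | CComp f g => CComp (strip f) (strip g)
  | CRec f g => CRec (strip f) (strip g)
  | CMu f => CMu (strip f)
  | _ => c
  end.

Lemma eval_strip A k c : pext (eval k emptyset c) (eval k A (strip c)).
Proof.
elim: k c => [//|k IH] [| | | | |f g|f g|f g|f] x y //.
- rewrite /=; case E: (eval k _ f x) => [a|//]; case E2: (eval k _ g x) => [b|//].
  by rewrite (IH _ _ _ E) (IH _ _ _ E2).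
- by rewrite /=; case E: (eval k _ g x) => [a|//]; rewrite (IH _ _ _ E); apply: IH.
- by rewrite [strip _]/= !eval_rec; apply: rec_loop_ext.
- by rewrite [strip _]/= !eval_mu; apply: mu_loop_ext.
Qed.

Lemma comp_lift A (T U : Type) {ET : Enc T} {EU : Enc U} (f : T -> U) :
  Acomputable emptyset f -> Acomputable A f.
Proof. by move=> [c H]; exists (strip c) => x; have [k K] := H x; exists k; apply: eval_strip. Qed.

Lemma evalsto_pairI A f g x y : evalsto A (CPair f g) x y ->
  exists a b, [/\ evalsto A f x a, evalsto A g x b & y = cpair a b].
Proof.
move=> [[//|k]] /=; case E: (eval k A f x) => [a|//]; case E2: (eval k A g x) => [b|//] [<-].
by exists a, b; split=> //; exists k.
Qed.

Lemma evalsto_compI A f g x y : evalsto A (CComp f g) x y ->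
  exists2 a, evalsto A g x a & evalsto A f a y.
Proof.
move=> [[//|k]] /=; case E: (eval k A g x) => [a|//] H.
by exists a; exists k.
Qed.

Lemma evalsto_muI A f x y : evalsto A (CMu f) x y -> evalsto A f (cpair y x) 0 /\
  forall j, j < y -> exists v, evalsto A f (cpair j x) v.+1.
Proof.
move=> [[//|k]]; rewrite eval_mu => /mu_loopI[_ H1 H2]; split; first by exists k.
by move=> j /H2[v H]; exists v; exists k.
Qed.

Lemma comp_encode_const A (X : Type) {EX : Enc X} (f : X -> nat) :
  Acomputable A f -> Acomputable A (fun x => encode (const_code (f x))).
Proof.
move=> F; apply: (comp_ext (f := fun x => nrec (fun _ a => 9 * cpair 1 a + 6) 0 (f x))) => [x|].
  by elim: (f x) => //= n ->.
by comp_tac.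
Qed.

Section Enumeration.
Context (A : nat -> bool) (T : Type) {ET : Enc T}.

(** An instance of the s-m-n theorem: the index is one fixed search program with the constant
    [enc v] inserted. It is therefore computable from [v] under every oracle, although the search
    itself may consult [A]. *)
Lemma enumeration (p : T -> nat -> nat -> bool) :
  Acomputable A (fun q : T * (nat * nat) => p q.1 q.2.1 q.2.2) ->
  exists2 r : T -> nat, (forall B, Acomputable B r) &
    forall v k, inWA A (r v) k <-> exists s, p v k s.
Proof.
move=> P.
have [d D] : Acomputable A (fun q : nat * (T * nat) => ~~ p q.2.1 q.2.2 q.1).
  comp_tac.
  by apply: (comp_comp P (f := fun q : nat * (T * nat) => (q.2.1, (q.2.2, q.1)))); comp_tac.
exists (fun v => encode (CComp (CMu d) (CPair (const_code (enc v)) (CPair CFst CSnd)))).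
  move=> B; apply: (comp_ext (f := fun v : T => 9 * cpair (encode (CMu d))
     (9 * cpair (encode (const_code (enc v))) (encode (CPair CFst CSnd)) + 5) + 6)) => //.
  by comp_tac; apply: comp_encode_const; comp_tac.
have I k : evalsto A (CPair CFst CSnd) k k.
  rewrite -{2}(cunpairK k).
  by apply: evalsto_pair; [apply: evalsto_fst|apply: evalsto_snd].
move=> v k; rewrite /inWA /Phi encodeK; split.
- move=> [y] /evalsto_compI[z] /evalsto_pairI[a [b [Ha Hb ->]]].
  rewrite (evalsto_det Ha (evalsto_const _ _ _)) (evalsto_det Hb (I k)).
  move=> /evalsto_muI[H _]; exists y.
  have := evalsto_det (D (y, (v, k))) H.
  by rewrite /=; case: (p v k y).
move=> [s Hs].
have [y Hy Hm] := ex_minnP (ex_intro (fun s => is_true (p v k s)) s Hs).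
exists y; apply: evalsto_comp (evalsto_pair (evalsto_const _ _ _) (I k)) _.
apply: evalsto_mu; first by have := D (y, (v, k)); rewrite /= Hy.
move=> j Hj; exists 0; have := D (j, (v, k)) => /=.
case E: (p v k j) => //=.
by have := Hm _ E; rewrite leqNgt Hj.
Qed.

End Enumeration.

(** Surjective codings serve where arbitrary numbers are read as certificates or as lists of
    strings. *)
Class EncBij (T : Type) {ET : Enc T} := { dec : nat -> T; decK : forall n, enc (dec n) = n }.
Arguments EncBij T {ET}.
Arguments dec T {ET EncBij} n.

#[global] Instance EncBij_nat : EncBij nat := {| dec := fun n : nat => n; decK := fun n => erefl n |}.

Section DecProd.
Context (T U : Type) {ET : Enc T} {EU : Enc U} {BT : EncBij T} {BU : EncBij U}.
Definition dec_prod n := (dec T (cunpair n).1, dec U (cunpair n).2).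
Lemma dec_prodK n : enc (dec_prod n) = n.
Proof. by rewrite /enc /= /enc_prod /= !decK cunpairK. Qed.
#[global] Instance EncBij_prod : EncBij (T * U) := {| decK := dec_prodK |}.
End DecProd.

Section DecSeq.
Context (T : Type) {ET : Enc T} {BT : EncBij T}.
Fixpoint dec_seq_aux k n :=
  if k is k'.+1 then
    if n is m.+1 then dec T (cunpair m).1 :: dec_seq_aux k' (cunpair m).2 else [::]
  else [::].
Definition dec_seq n := dec_seq_aux n n.
Lemma dec_seqK n : enc (dec_seq n) = n.
Proof.
have H : forall k m, m <= k -> enc_seq (dec_seq_aux k m) = m.
  elim=> [|k IH] [|m] //=; rewrite ltnS => H.
  by rewrite decK IH ?cunpairK //; apply: leq_trans H; apply (leq_cunpair m).
exact: H.
Qed.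
#[global] Instance EncBij_seq : EncBij (seq T) := {| decK := dec_seqK |}.
End DecSeq.

Lemma encK (T : Type) {ET : Enc T} {BT : EncBij T} (x : T) : dec T (enc x) = x.
Proof. by apply: enc_inj; rewrite decK. Qed.

Lemma comp_dec A (X T : Type) {EX : Enc X} {ET : Enc T} {BT : EncBij T} (f : X -> nat) :
  Acomputable A f -> Acomputable A (fun x => dec T (f x)).
Proof. by move=> F; apply: comp_enc F _ => x; rewrite decK. Qed.

Ltac comp_user5 := fail.
Ltac comp_user4 ::=
  lazymatch goal with
  | |- Acomputable _ (fun x => dec _ _) => apply: comp_dec
  | |- Acomputable _ (fun x => encode (const_code _)) => apply: comp_encode_const
  | |- _ => comp_user5
  end.

(** * Stage approximations of c.e. sets through certificates of computations *)

Section Universal.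
Context (A : nat -> bool).
Implicit Types (l : seq (nat * nat * nat)) (q : nat * nat * nat).

(* A certificate is a list of triples (e, x, y) claiming that program e maps x
   to y; every claim must follow from claims further down the list. *)
Definition justified l q : bool :=
  let e := q.1.1 in let x := q.1.2 in let y := q.2 in
  let c := e %% 9 in let m := e %/ 9 in
  let el := (cunpair m).1 in let er := (cunpair m).2 in
  if c == 0 then y == 0 else
  if c == 1 then y == x.+1 else
  if c == 2 then y == (cunpair x).1 else
  if c == 3 then y == (cunpair x).2 else
  if c == 4 then y == A x else
  if c == 5 then ((el, x, (cunpair y).1) \in l) && ((er, x, (cunpair y).2) \in l) else
  if c == 6 then has (fun p => (p.1 == (er, x)) && ((el, p.2, y) \in l)) l else
  if c == 7 then
    if (cunpair x).1 == 0 then (el, (cunpair x).2, y) \in l else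
    has (fun p => (p.1 == (e, cpair (cunpair x).1.-1 (cunpair x).2)) &&
      ((er, cpair (cunpair x).1.-1 (cpair p.2 (cunpair x).2), y) \in l)) l
  else ((m, cpair y x, 0) \in l) &&
    all (fun j => has (fun p => (p.1 == (m, cpair j x)) && (0 < p.2)) l) (iota 0 y).

Fixpoint valid l := if l is q :: l' then valid l' && justified l' q else true.

Lemma comp_justified :
  Acomputable A (fun z : seq (nat * nat * nat) * (nat * nat * nat) => justified z.1 z.2).
Proof. by rewrite /justified; comp_tac; apply: comp_oracle; comp_tac. Qed.

Lemma comp_valid : Acomputable A valid.
Proof.
apply: (comp_ext (f := fun l => (foldr (fun q st => (st.1 && justified st.2 q, q :: st.2)) (true, [::]) l).1)).
  move=> l; suff -> : foldr (fun q st => (st.1 && justified st.2 q, q :: st.2)) (true, [::]) l = (valid l, l) by [].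
  by elim: l => //= q l ->.
comp_tac.
by apply: (comp_comp comp_justified (f := fun q : seq (nat * nat * nat) * (nat * nat * nat * (bool * seq (nat * nat * nat))) => (q.2.2.2, q.2.1))); comp_tac.
Qed.

Lemma justified_sub l l' q : {subset l <= l'} -> justified l q -> justified l' q.
Proof.
move=> S; have Sh p : has p l -> has p l'.
  by move=> /hasP[z /S Hz Hp]; apply/hasP; exists z.
rewrite /justified; do 5 (case: ifP => // _).
case: ifP => [_ /andP[/S -> /S ->] //|_].
case: ifP => [_|_].
  by move=> /hasP[z /S Hz /andP[H1 /S H2]]; apply/hasP; exists z => //; rewrite H1.
case: ifP => [_|_].
  case: ifP => [_ /S //|_].
  by move=> /hasP[z /S Hz /andP[H1 /S H2]]; apply/hasP; exists z => //; rewrite H1.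
by move=> /andP[/S -> /allP H]; apply/allP => j /H /Sh.
Qed.

Lemma justified_sound l q : (forall p, p \in l -> evalsto A (decode p.1.1) p.1.2 p.2) ->
  justified l q -> evalsto A (decode q.1.1) q.1.2 q.2.
Proof.
case: q => [[e x] y] /= Hl; rewrite decodeE /justified /=.
have := ltn_pmod e (isT : 0 < 9).
move E: (e %% 9) => c; case: c E => [|[|[|[|[|[|[|[|[|//]]]]]]]]] E _ /=.
- by move=> /eqP ->; apply: evalsto_zero.
- by move=> /eqP ->; apply: evalsto_succ.
- by move=> /eqP ->; apply: evalsto_fst.
- by move=> /eqP ->; apply: evalsto_snd.
- by move=> /eqP ->; apply: evalsto_oracle.
- move=> /andP[/Hl /= H1 /Hl /= H2]; rewrite -(cunpairK y); exact: evalsto_pair.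
- move=> /hasP[[p z] /Hl /= H1 /andP[/eqP Ep /Hl /= H2]].
  by rewrite Ep /= in H1; apply: evalsto_comp H1 H2.
- have Ex := cunpairK x; case: ifP => [/eqP E0 /Hl /= H|].
    by rewrite -Ex E0; apply: evalsto_rec0.
  case: (cunpair x) Ex => -[//|n] w /= Ex _ /hasP[[p z] /Hl /= H1 /andP[/eqP Ep /Hl /= H2]].
  rewrite Ep /= decodeE E /= in H1.
  by rewrite -Ex; apply: evalsto_recS H1 H2.
move=> /andP[/Hl /= H1 /allP H2]; apply: evalsto_mu => // j Hj.
have /H2 : j \in iota 0 y by rewrite mem_iota.
move=> /hasP[[p z] /Hl /= H3 /andP[/eqP Ep]]; case: z H3 => // v H3 _.
by exists v; rewrite Ep in H3.
Qed.

Lemma valid_sound l q : valid l -> q \in l -> evalsto A (decode q.1.1) q.1.2 q.2.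
Proof.
elim: l q => //= p l IH q /andP[/IH Hl Hj]; rewrite inE => /orP[/eqP ->|]; last exact: Hl.
exact: justified_sound Hj.
Qed.

Lemma valid_cat l l' : valid l -> valid l' -> valid (l ++ l').
Proof.
move=> Hl Hl'; elim: l Hl => //= q l IH /andP[/IH -> /=].
by apply: justified_sub => z Hz; rewrite mem_cat Hz.
Qed.

Definition certifiable q := exists2 l, valid l & q \in l.

(** Certificates of the claims in [l] are concatenated; the result stays valid because justification
    survives in larger lists, and the new claim goes on top. *)
Lemma certifiable_justified l q : (forall p, p \in l -> certifiable p) -> justified l q ->
  certifiable q.
Proof.
move=> Hl Hj.
have [l' V S] : exists2 l', valid l' & {subset l <= l'}.
  elim: l Hl {Hj} => [|p l IH] Hl; first by exists [::].
  have [|l1 V1 S1] := IH; first by move=> z Hz; apply: Hl; rewrite inE Hz orbT.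
  have [l2 V2 S2] := Hl p (mem_head _ _).
  exists (l2 ++ l1); first exact: valid_cat.
  move=> z; rewrite inE mem_cat => /orP[/eqP -> |/S1 ->]; by rewrite ?S2 ?orbT.
exists (q :: l'); last exact: mem_head.
by rewrite /= V /=; apply: justified_sub Hj.
Qed.

Lemma certifiable_eval k e x y : eval k A (decode e) x = Some y -> certifiable (e, x, y).
Proof.
elim: k e x y => [//|k IH] e x y.
rewrite decodeE; have := ltn_pmod e (isT : 0 < 9).
move E: (e %% 9) => c; case: c E => [|[|[|[|[|[|[|[|[|//]]]]]]]]] E _ /=.
- by move=> [<-]; apply: (@certifiable_justified [::]) => //; rewrite /justified /= E.
- by move=> [<-]; apply: (@certifiable_justified [::]) => //; rewrite /justified /= E /= eqxx.
- by move=> [<-]; apply: (@certifiable_justified [::]) => //; rewrite /justified /= E /= eqxx.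
- by move=> [<-]; apply: (@certifiable_justified [::]) => //; rewrite /justified /= E /= eqxx.
- by move=> [<-]; apply: (@certifiable_justified [::]) => //; rewrite /justified /= E /= eqxx.
- set el := (cunpair (e %/ 9)).1; set er := (cunpair (e %/ 9)).2.
  case E1: (eval k A _ x) => [a|//]; case E2: (eval k A _ x) => [b|//] [<-].
  apply: (@certifiable_justified [:: (el, x, a); (er, x, b)]).
    by move=> p; rewrite !inE => /orP[] /eqP ->; apply: IH.
  by rewrite /justified /= E /= cpairK /= -/el -/er !inE !eqxx orbT.
- set el := (cunpair (e %/ 9)).1; set er := (cunpair (e %/ 9)).2.
  case E1: (eval k A _ x) => [a|//] E2.
  apply: (@certifiable_justified [:: (er, x, a); (el, a, y)]).
    by move=> p; rewrite !inE => /orP[] /eqP ->; apply: IH.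
  by rewrite /justified /= E /= -/el -/er !inE !eqxx orbT.
- set el := (cunpair (e %/ 9)).1; set er := (cunpair (e %/ 9)).2.
  rewrite -/(rec_loop (eval k A (decode el)) (eval k A (decode er)) (cunpair x).2 (cunpair x).1).
  have := cunpairK x; case: (cunpair x) => n w /= <- {x}.
  elim: n y => [|n IHn] y /=.
    move=> /IH H; apply: (@certifiable_justified [:: (el, w, y)]).
      by move=> p; rewrite !inE => /eqP ->.
    by rewrite /justified /= E /= cpairK /= -/el -/er !inE !eqxx.
  rewrite -/(rec_loop (eval k A (decode el)) (eval k A (decode er)) w n).
  case: rec_loop IHn => [a|//] /(_ _ erefl) H1 /IH H2.
  apply: (@certifiable_justified [:: (e, cpair n w, a); (er, cpair n (cpair a w), y)]).
    by move=> p; rewrite !inE => /orP[] /eqP ->.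
  by rewrite /justified /= E /= cpairK /= -/el -/er !inE !eqxx orbT.
rewrite -/(mu_loop (eval k A (decode (e %/ 9))) x k 0) => /mu_loopI[_ /IH H1 H2].
(* A certificate for a search must also contain the nonzero values met before the least zero; their
   predecessors are gathered in a list. *)
have [vs Hvs] : exists vs, forall j, j < y -> eval k A (decode (e %/ 9)) (cpair j x) = Some (nth 0 vs j).+1.
  elim: y {H1} H2 => [|n IHn] H2; first by exists [::].
  have [|vs Hvs] := IHn; first by move=> j Hj; apply: H2; lia.
  have [|v Hv] := H2 n; first by lia.
  exists (mkseq (fun j => if j == n then v else nth 0 vs j) n.+1) => j Hj.
  rewrite nth_mkseq //; case: eqP => [-> //|Hn].
  by apply: Hvs; lia.
apply: (@certifiable_justified ((e %/ 9, cpair y x, 0) ::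
   [seq (e %/ 9, cpair j x, (nth 0 vs j).+1) | j <- iota 0 y])).
  move=> p; rewrite !inE => /orP[/eqP -> //|/mapP[j]]; rewrite mem_iota /= add0n => Hj ->.
  exact/IH/Hvs.
rewrite /justified /= E /= mem_head /=; apply/allP => j Hj.
apply/orP; right; apply/hasP; exists (e %/ 9, cpair j x, (nth 0 vs j).+1).
  by apply/mapP; exists j.
by rewrite eqxx.
Qed.

(** Stage [s] looks only at certificates with code below [s], and [wlist] only at elements below
    [s]. The stages are thus finite, increasing and computable in [A], uniformly in the index. *)
Definition wmem e x s :=
  has (fun z => let l := dec (seq (nat * nat * nat)) z in valid l && has (fun q => q.1 == (e, x)) l) (iota 0 s).

Definition wlist e s := [seq x <- iota 0 s | wmem e x s].

Lemma comp_wlist (X : Type) {EX : Enc X} (f g : X -> nat) :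
  Acomputable A f -> Acomputable A g -> Acomputable A (fun x => wlist (f x) (g x)).
Proof.
move=> F G; rewrite /wlist /wmem; comp_tac.
by apply: (comp_comp comp_valid); comp_tac.
Qed.

Lemma wmem_mono e x s s' : s <= s' -> wmem e x s -> wmem e x s'.
Proof.
move=> H /hasP[z Hz Hv]; apply/hasP; exists z => //.
by move: Hz; rewrite !mem_iota; lia.
Qed.

Lemma wlist_mono e s s' : s <= s' -> {subset wlist e s <= wlist e s'}.
Proof.
move=> H x; rewrite !mem_filter !mem_iota => /andP[/(wmem_mono H) -> /=]; lia.
Qed.

Lemma wlist_inWA e s x : x \in wlist e s -> inWA A e x.
Proof.
rewrite mem_filter => /andP[/hasP[z _ /andP[V /hasP[q Hq /eqP E]]] _].
by exists q.2; have := valid_sound V Hq; rewrite E.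
Qed.

Lemma inWA_wlist e x : inWA A e x -> exists s, forall s', s <= s' -> x \in wlist e s'.
Proof.
move=> [y [k /certifiable_eval[l V Hl]]].
exists (maxn x (enc l)).+1 => s' Hs; rewrite mem_filter mem_iota; apply/andP; split; last by lia.
apply/hasP; exists (enc l); first by rewrite mem_iota; lia.
by rewrite encK /= V; apply/hasP; exists (e, x, y).
Qed.

Lemma wlist_lt e s x : x \in wlist e s -> x < s.
Proof. by rewrite mem_filter mem_iota => /andP[_]. Qed.

End Universal.

Ltac comp_user6 := fail.
Ltac comp_user5 ::=
  lazymatch goal with
  | |- Acomputable _ (fun x => wlist _ _ _) => apply: comp_wlist
  | |- _ => comp_user6
  end.

(** * Functions that are omega-c.e. by an oracle *)

Lemma comp_find A (X T : Type) {EX : Enc X} {ET : Enc T} (F : X -> T -> bool) (s : X -> seq T) :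
  Acomputable A (fun q : X * T => F q.1 q.2) -> Acomputable A s -> Acomputable A (fun x => find (F x) (s x)).
Proof.
move=> HF S; apply: (comp_ext (f := fun x => foldr (fun a r => if F x a then 0 else r.+1) 0 (s x))) => [x|].
  by elim: (s x) => //= a l ->.
comp_tac.
by apply: (comp_comp HF (f := fun q : X * (T * nat) => (q.1, q.2.1))); comp_tac.
Qed.
Ltac comp_user7 := fail.
Ltac comp_user6 ::=
  lazymatch goal with
  | |- Acomputable _ (fun x => find _ _) => apply: comp_find
  | |- _ => comp_user7
  end.

Definition changes (U : eqType) (G : nat -> U) n := count (fun t => G t.+1 != G t) (iota 0 n).

Lemma changesS (U : eqType) (G : nat -> U) n : changes G n.+1 = changes G n + (G n.+1 != G n).
Proof. by rewrite /changes -[in LHS]addn1 iotaD count_cat /= addn0. Qed.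

(** The notion [omega_ce_by] for coded types: the approximation may use [A], the bound on its
    changes may not. *)
Definition oce A (T : Type) (U : eqType) {ET : Enc T} {EU : Enc U} (F : T -> U) :=
  exists (G : T -> nat -> U) (b : T -> nat),
    [/\ Acomputable A (fun q : T * nat => G q.1 q.2), Acomputable emptyset b,
        forall x, exists s, forall t, s <= t -> G x t = F x &
        forall x n, changes (G x) n <= b x].

Lemma omega_ce_byP A f : omega_ce_by A f <-> oce A f.
Proof.
split=> [[g [b [H1 H2 H3 H4]]]|[g [b [H1 H2 H3 H4]]]]; exists g, b; split=> //.
- exact/A_computable2P.
- exact/A_computableP.
- exact/A_computable2P.
- exact/A_computableP.
Qed.

Lemma leq_changes (U V : eqType) (G : nat -> U) (H : nat -> V) n :
  (forall t, H t.+1 = H t -> G t.+1 = G t) -> changes G n <= changes H n.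
Proof. by move=> E; apply: sub_count => t; apply: contra => /eqP/E ->. Qed.

Section Closure.
Context (A : nat -> bool).

Lemma oce_comp (T : Type) (U V : eqType) {ET : Enc T} {EU : Enc U} {EV : Enc V}
  (F : T -> U) (p : T -> U -> V) :
  oce A F -> Acomputable A (fun q : T * U => p q.1 q.2) -> oce A (fun x => p x (F x)).
Proof.
move=> [G [b [H1 H2 H3 H4]]] P; exists (fun x t => p x (G x t)), b; split=> //.
- by apply: (comp_comp P (f := fun q : T * nat => (q.1, G q.1 q.2))); comp_tac.
- by move=> x; have [s Hs] := H3 x; exists s => t /Hs ->.
- by move=> x n; apply: leq_trans (H4 x n); apply: leq_changes => t ->.
Qed.

(** The map [c] has to be computable without the oracle because it enters the bound on the
    changes. *)
Lemma oce_reindex (S T : Type) (U : eqType) {ES : Enc S} {ET : Enc T} {EU : Enc U}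
  (F : T -> U) (c : S -> T) :
  oce A F -> Acomputable emptyset c -> oce A (fun x => F (c x)).
Proof.
move=> [G [b [H1 H2 H3 H4]]] C; exists (fun x => G (c x)), (fun x => b (c x)); split=> //.
- have C' := comp_lift A C.
  by apply: (comp_comp H1 (f := fun q : S * nat => (c q.1, q.2))); comp_tac.
- exact: comp_comp.
Qed.

Lemma oce_pair (T : Type) (U V : eqType) {ET : Enc T} {EU : Enc U} {EV : Enc V}
  (F : T -> U) (F' : T -> V) : oce A F -> oce A F' -> oce A (fun x => (F x, F' x)).
Proof.
move=> [G [b [H1 H2 H3 H4]]] [G' [b' [H1' H2' H3' H4']]].
exists (fun x t => (G x t, G' x t)), (fun x => b x + b' x); split=> //.
- by comp_tac.
- by comp_tac.
- move=> x; have [s Hs] := H3 x; have [s' Hs'] := H3' x; exists (maxn s s') => t Ht.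
  by rewrite Hs ?Hs' //; lia.
- move=> x n; apply: leq_trans (leq_add (H4 x n) (H4' x n)).
  elim: n => // n IH; rewrite !changesS xpair_eqE negb_and; lia.
Qed.

Lemma oce_list (S T : Type) (U : eqType) {ES : Enc S} {ET : Enc T} {EU : Enc U}
  (F : T -> U) (idx : S -> nat -> T) (c : S -> nat) :
  oce A F -> Acomputable emptyset (fun q : S * nat => idx q.1 q.2) -> Acomputable emptyset c ->
  oce A (fun x => [seq F (idx x j) | j <- iota 0 (c x)]).
Proof.
move=> [G [b [H1 H2 H3 H4]]] I C.
exists (fun x t => [seq G (idx x j) t | j <- iota 0 (c x)]),
       (fun x => sumn [seq b (idx x j) | j <- iota 0 (c x)]); split=> //.
- have C' := comp_lift A C; have I' := comp_lift A I; comp_tac.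
  apply: (comp_comp H1 (f := fun q : (S * nat) * nat => (idx q.1.1 q.2, q.1.2))); comp_tac.
  by apply: (comp_comp I' (f := fun q : (S * nat) * nat => (q.1.1, q.2))); comp_tac.
- comp_tac; apply: (comp_comp H2 (f := fun q : S * nat => idx q.1 q.2)); by comp_tac.
- move=> x; elim: (iota 0 (c x)) => [|j l [s Hs]]; first by exists 0.
  have [s' Hs'] := H3 (idx x j); exists (maxn s s') => t Ht /=.
  by rewrite Hs ?Hs' //; lia.
- move=> x n; elim: (iota 0 (c x)) => [|j l IH] /=.
    by rewrite leqNgt -has_count; apply/hasPn => t.
  apply: leq_trans (leq_add (H4 (idx x j) n) IH).
  elim: n {IH} => // n IH; rewrite !changesS eqseq_cons negb_and; lia.
Qed.

Lemma find_iota_least (p : nat -> bool) n s :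
  p s -> (forall j, j < s -> ~~ p j) -> s <= n -> find p (iota 0 n) = s.
Proof.
move=> Ps Hs Hn.
have Hi : iota 0 n = iota 0 s ++ iota s (n - s) by rewrite -{1}(subnKC Hn) iotaD.
rewrite Hi find_cat size_iota.
have -> : has p (iota 0 s) = false.
  by apply/hasPn => j; rewrite mem_iota => /Hs.
case E: (n - s) => [|m] /=; first by rewrite addn0.
by rewrite Ps addn0.
Qed.

(* The approximation changes only when that of [F] does or when [mu], which is
   monotone and bounded by [B], increases: at most (b+1)(B+1) times. *)
Lemma oce_stage (T : Type) (V : eqType) {ET : Enc T} {EV : Enc V}
  (F : T -> V) (mu : T -> V -> nat -> nat) (B : T -> nat) :
  oce A F -> Acomputable A (fun q : T * (V * nat) => mu q.1 q.2.1 q.2.2) -> Acomputable emptyset B ->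
  (forall x v s, mu x v s <= mu x v s.+1) -> (forall x v s, mu x v s <= B x) ->
  exists st : T -> nat, oce A (fun x => (F x, st x)) /\
    forall x s, st x <= s -> mu x (F x) s = mu x (F x) (st x).
Proof.
move=> [G [b [H1 H2 H3 H4]]] M CB Hm Hb.
have Hmono x v : {homo mu x v : s s' / s <= s'}.
  by apply: homo_leq => // m n p; apply: leq_trans.
(* A bounded nondecreasing sequence stabilizes: induction on a bound for its distance to [B x], with
   excluded middle on whether it still increases. *)
have lim x v : exists s, forall t, s <= t -> mu x v t = mu x v s.
  have [n Hn] : exists n, forall t, B x - mu x v t <= n by exists (B x) => t; lia.
  have {Hn} : exists s, forall t, s <= t -> B x - mu x v t <= n by exists 0.
  elim: n => [|n IH] [s Hs].
    exists s => t Ht; have := Hs t Ht; have := Hs s (leqnn _).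
    by have := Hb x v t; have := Hb x v s; have := Hmono x v _ _ Ht; lia.
  case: (classic (exists2 t, s <= t & mu x v s < mu x v t)) => [[t Ht Hlt]|N].
    apply: IH; exists t => u Hu; have := Hs s (leqnn _); have := Hmono x v _ _ Hu.
    by have := Hb x v u; lia.
  exists s => t Ht; apply/eqP; rewrite eqn_leq (Hmono _ _ _ _ Ht) andbT leqNgt.
  by apply/negP => Hlt; apply: N; exists t.
have [J HJ] : exists J : T -> nat, forall x, exists s, forall t, s <= t -> mu x (F x) t = J x.
  apply: (choice (fun x j => exists s, forall t, s <= t -> mu x (F x) t = j)) => x.
  by have [s Hs] := lim x (F x); exists (mu x (F x) s), s.
have least x : exists s, mu x (F x) s == J x.
  by have [s Hs] := HJ x; exists s; rewrite Hs.
pose st x := ex_minn (least x).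
have st1 x : mu x (F x) (st x) = J x by rewrite /st; case: ex_minnP => s /eqP.
have st2 x j : j < st x -> mu x (F x) j != J x.
  rewrite /st; case: ex_minnP => s _ Hs Hj; apply/negP => /Hs; lia.
have st3 x s : st x <= s -> mu x (F x) s = J x.
  move=> H; have [s' Hs'] := HJ x; apply/eqP; rewrite eqn_leq; apply/andP; split.
    by rewrite -(Hs' (maxn s s') (leq_maxr _ _)) Hmono // leq_maxl.
  by rewrite -(st1 x) Hmono.
exists st; split; last by move=> x s /st3 ->; rewrite st1.
(* The first stage at which [mu] has its current value; for fixed [v] it moves only when this value
   does. *)
pose fst_stage x v t := find (fun s => mu x v s == mu x v t) (iota 0 t).
have fsE x v t s : mu x v s = mu x v t -> s <= t ->
    fst_stage x v t = find (fun j => mu x v j == mu x v s) (iota 0 s).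
  move=> E Hs; rewrite /fst_stage.
  have X : exists j, mu x v j == mu x v s by exists s.
  have [m Pm Mm] := ex_minnP X.
  have Hms : m <= s by apply: Mm.
  have Hmin j : j < m -> ~~ (mu x v j == mu x v s).
    by move=> Hj; apply/negP => /Mm; lia.
  rewrite -E !(@find_iota_least _ _ m) //; exact: leq_trans Hs.
exists (fun x t => (G x t, fst_stage x (G x t) t)), (fun x => b x * (B x).+1 + B x); split.
- rewrite /fst_stage; comp_tac.
    by apply: (comp_comp M (f := fun q : T * nat * nat => (q.1.1, (G q.1.1 q.1.2, q.2)))); comp_tac;
       apply: (comp_comp H1 (f := fun q : T * nat * nat => (q.1.1, q.1.2))); comp_tac.
  by apply: (comp_comp M (f := fun q : T * nat * nat => (q.1.1, (G q.1.1 q.1.2, q.1.2)))); comp_tac;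
     apply: (comp_comp H1 (f := fun q : T * nat * nat => (q.1.1, q.1.2))); comp_tac.
- by comp_tac.
- move=> x; have [s Hs] := H3 x; exists (maxn s (st x)) => t Ht.
  rewrite Hs; last by lia.
  congr (_, _); rewrite /fst_stage (@find_iota_least _ _ (st x)) //.
  + by rewrite st1 st3 //; lia.
  + by move=> j /st2; rewrite (st3 x t) //; lia.
  + by lia.
- move=> x n.
  (* A change of [G] may let [mu] drop by up to [B x]; the factor [(B x).+1] pays for this drop and
     for the change itself. *)
  suff H : changes (fun t => (G x t, fst_stage x (G x t) t)) n <=
           changes (G x) n * (B x).+1 + mu x (G x n) n.
    by apply: leq_trans H _; apply: leq_add (Hb _ _ _); rewrite leq_mul2r H4 orbT.
  elim: n => [|n IH]; first by [].
  rewrite !changesS xpair_eqE; case: eqP => [E|_] /=; last first.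
    rewrite mulnDl mul1n; have := Hb x (G x n) n; lia.
  rewrite addn0 E; case: eqP => [_|N] /=; have := Hm x (G x n) n; first by lia.
  suff: mu x (G x n) n.+1 != mu x (G x n) n by lia.
  apply/eqP => E2; apply: N; exact: fsE (esym E2) (leqnSn n).
Qed.

End Closure.

(** * Measure of clopen sets *)

(** The value of the string behind a leading digit 1, which matches the coding of strings by
    [str_of_nat]. *)
Definition strval (s : seq bool) := foldl (fun m (b : bool) => b + m.*2) 1 s.
Arguments strval : simpl never.
Definition nat_of_str s := (strval s).-1.

Lemma strval_rcons s b : strval (rcons s b) = b + (strval s).*2.
Proof. by rewrite /strval -cats1 foldl_cat. Qed.

Lemma strval_bounds s : 2 ^ size s <= strval s < 2 ^ (size s).+1.
Proof.
elim/last_ind: s => [//|s b IH]; rewrite strval_rcons size_rcons.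
by move: IH; rewrite !expnS; case: b; lia.
Qed.

Lemma strval_gt0 s : 0 < strval s.
Proof. by have := strval_bounds s; have := expn_gt0 2 (size s); lia. Qed.

Lemma str_aux_strval k s : strval s <= k -> str_aux k (strval s) = s.
Proof.
elim/last_ind: s k => [|s b IH] [|k] //=.
- by have := strval_gt0 (rcons s b); lia.
have H0 := strval_gt0 s; rewrite strval_rcons => Hk.
have -> : (b + (strval s).*2 <= 1) = false by case: (b) Hk; lia.
have -> : (b + (strval s).*2)./2 = strval s by rewrite half_bit_double.
rewrite oddD odd_double addbF IH; first by case: (b).
by case: (b) Hk; lia.
Qed.

Lemma nat_of_strK s : str_of_nat (nat_of_str s) = s.
Proof. by rewrite /str_of_nat /nat_of_str prednK ?strval_gt0 // str_aux_strval. Qed.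

Lemma strval_str_aux k m : 0 < m <= k -> strval (str_aux k m) = m.
Proof.
elim: k m => [|k IH] m /=; first by lia.
move=> H2; case: (leqP m 1) => H1; first by rewrite /strval /=; lia.
rewrite strval_rcons IH; last by lia.
by rewrite odd_double_half.
Qed.

Lemma str_of_natK n : nat_of_str (str_of_nat n) = n.
Proof. by rewrite /nat_of_str /str_of_nat strval_str_aux ?leqnn. Qed.

Lemma size_str_of_nat n N : (size (str_of_nat n) == N) = (2 ^ N <= n.+1 < 2 ^ N.+1).
Proof.
have E : strval (str_of_nat n) = n.+1 by rewrite /str_of_nat strval_str_aux ?leqnn.
have := strval_bounds (str_of_nat n); rewrite E => /andP[H1 H2].
apply/eqP/idP => [<-|/andP[H3 H4]]; first by rewrite H1.
apply/eqP; rewrite eqn_leq; apply/andP; split; rewrite -ltnS -(ltn_exp2l _ _ (ltnSn 1)).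
  exact: leq_ltn_trans H1 H4.
exact: leq_ltn_trans H3 H2.
Qed.

Lemma size_str_le n : size (str_of_nat n) <= n.
Proof.
have := size_str_of_nat n (size (str_of_nat n)); rewrite eqxx => /esym/andP[H _].
by rewrite -ltnS; apply: leq_trans H; apply: ltn_expl.
Qed.

(** Strings of length [N] have consecutive codes by [size_str_of_nat]. An explicit list replaces the
    tuples of [measure_le] because the count has to be computable. *)
Definition strs N := [seq str_of_nat x | x <- iota (2 ^ N).-1 (2 ^ N)].
Definition cnt N (P : pred (seq bool)) := count P (strs N).

Lemma mem_strs N s : (s \in strs N) = (size s == N).
Proof.
have H := expn_gt0 2 N.
apply/mapP/idP => [[x]|].
  by rewrite mem_iota => Hx ->; rewrite size_str_of_nat expnS; lia.
rewrite -{1}(nat_of_strK s) size_str_of_nat => Hs.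
exists (nat_of_str s); last by rewrite nat_of_strK.
by move: Hs; rewrite mem_iota expnS; lia.
Qed.

Lemma uniq_strs N : uniq (strs N).
Proof. by rewrite map_inj_uniq ?iota_uniq //; apply: (can_inj str_of_natK). Qed.

Lemma size_strs N : size (strs N) = 2 ^ N.
Proof. by rewrite size_map size_iota. Qed.

Lemma card_tuples_cnt N (P : pred (seq bool)) : #|[pred t : N.-tuple bool | P (tval t)]| = cnt N P.
Proof.
rewrite /cnt.
have -> : count P (strs N) = count P (map val (enum {: N.-tuple bool})).
  apply/permP/uniq_perm; first exact: uniq_strs.
    by rewrite (map_inj_uniq val_inj) enum_uniq.
  move=> s; rewrite mem_strs; apply/idP/mapP => [Hs|[t _ ->]]; last by rewrite size_tuple.
  by exists (Tuple Hs) => //; rewrite mem_enum.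
rewrite count_map cardE -size_filter; congr size.
by rewrite enumT; apply: eq_filter.
Qed.

(** A string of length [N + k] is a free choice of its first [N] and its last [k] bits. This product
    rule is the source of the independence of the block sets. *)
Lemma cnt_cat N k (P Q : pred (seq bool)) :
  cnt (N + k) (fun t => P (take N t) && Q (drop N t)) = cnt N P * cnt k Q.
Proof.
have E : perm_eq (strs (N + k)) [seq a ++ b | a <- strs N, b <- strs k].
  apply: uniq_perm; first exact: uniq_strs.
    apply: allpairs_uniq; [exact: uniq_strs|exact: uniq_strs|].
    move=> [a b] [c d] /allpairsP[[a' b'] [Ha _ [-> _]]] /allpairsP[[c' d'] [Hc _ [-> _]]].
    rewrite !mem_strs /= in Ha Hc *; move=> /eqP; rewrite eqseq_cat ?(eqP Ha) ?(eqP Hc) //.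
    by move=> /andP[/eqP -> /eqP ->].
  move=> s; rewrite mem_strs; apply/idP/allpairsP => [/eqP Hs|[[a b] [/= Ha Hb ->]]].
    exists (take N s, drop N s); rewrite !mem_strs /= cat_take_drop size_drop Hs addKn.
    by rewrite size_takel ?Hs ?leq_addr // !eqxx.
  by rewrite !mem_strs in Ha Hb; rewrite size_cat (eqP Ha) (eqP Hb).
rewrite {1}/cnt (permP E).
have : all (fun s => size s == N) (strs N) by apply/allP => s; rewrite mem_strs.
rewrite [cnt N P]/cnt; elim: (strs N) => [|a l IH] //= /andP[/eqP Ha /IH H].
rewrite count_cat H mulnDl; congr (_ + _).
rewrite count_map (eq_count (a2 := fun b => P a && Q b)); last first.
  by move=> b /=; rewrite -Ha take_size_cat // drop_size_cat.
rewrite /cnt; case: (P a) => /=; first by rewrite mul1n.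
by rewrite mul0n (eq_count (a2 := pred0)) // count_pred0.
Qed.

Lemma cntT N : cnt N predT = 2 ^ N.
Proof. by rewrite /cnt count_predT size_strs. Qed.

Lemma leq_cnt N (P Q : pred (seq bool)) : (forall t, size t = N -> P t -> Q t) -> cnt N P <= cnt N Q.
Proof.
move=> H; rewrite /cnt -!size_filter.
rewrite -(@eq_in_filter _ (fun t => P t && (size t == N))); last first.
  by move=> t; rewrite mem_strs => ->; rewrite andbT.
by rewrite !size_filter; apply: sub_count => t /andP[Pt /eqP Ht]; exact: H.
Qed.

Lemma eq_cnt N (P Q : pred (seq bool)) : (forall t, size t = N -> P t = Q t) -> cnt N P = cnt N Q.
Proof. by move=> H; apply/eqP; rewrite eqn_leq !leq_cnt // => t Ht; rewrite H. Qed.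

Lemma cnt_split N (P Q : pred (seq bool)) :
  cnt N P = cnt N (fun t => P t && Q t) + cnt N (fun t => P t && ~~ Q t).
Proof.
by rewrite /cnt; elim: (strs N) => //= a l ->; case: (P a); case: (Q a) => /=; lia.
Qed.

Lemma cnt_take N k (P : pred (seq bool)) : cnt (N + k) (fun t => P (take N t)) = cnt N P * 2 ^ k.
Proof.
rewrite -[in RHS](cntT k) -cnt_cat; apply: eq_cnt => t _ /=; by rewrite andbT.
Qed.

Lemma cnt_drop N k (P : pred (seq bool)) : cnt (N + k) (fun t => P (drop N t)) = 2 ^ N * cnt k P.
Proof. by rewrite -[in RHS](cntT N) -cnt_cat; apply: eq_cnt. Qed.

(** * Measure at a finite resolution, as a rational number *)

Section Lam.
Import GRing.Theory Num.Theory Order.TTheory.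
Local Open Scope ring_scope.

Definition hlf (n : nat) : rat := 2%:R ^- n.

Lemma hlf_gt0 n : 0 < hlf n. Proof. by rewrite invr_gt0 exprn_gt0. Qed.
Lemma hlf_ge0 n : 0 <= hlf n. Proof. exact/ltW/hlf_gt0. Qed.
Lemma hlf0 : hlf 0 = 1. Proof. by rewrite /hlf expr0 invr1. Qed.
Lemma hlfS n : hlf n = 2 * hlf n.+1.
Proof. by rewrite /hlf exprS invfM mulrA divff ?mul1r. Qed.
Lemma hlfD m n : hlf (m + n) = hlf m * hlf n.
Proof. by rewrite /hlf exprD invfM. Qed.
Lemma hlf_le m n : (m <= n)%N -> hlf n <= hlf m.
Proof.
move=> H; rewrite /hlf lef_pV2 ?posrE ?exprn_gt0 //.
by apply: ler_weXn2l.
Qed.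
Lemma natr_exp2 n : (2 ^ n)%:R = (hlf n)^-1 :> rat.
Proof. by rewrite natrX /hlf invrK. Qed.
Lemma hlf_natr n : (2 ^ n)%:R * hlf n = 1.
Proof. by rewrite natr_exp2 mulVf // gt_eqF ?hlf_gt0. Qed.

Definition lam N P : rat := (cnt N P)%:R * hlf N.

Lemma le_lam N (P Q : pred (seq bool)) : (forall t, size t = N -> P t -> Q t) -> lam N P <= lam N Q.
Proof. by move=> H; rewrite ler_pM2r ?hlf_gt0 // ler_nat leq_cnt. Qed.

Lemma eq_lam N (P Q : pred (seq bool)) : (forall t, size t = N -> P t = Q t) -> lam N P = lam N Q.
Proof. by move=> H; rewrite /lam (eq_cnt H). Qed.

Lemma lamT N : lam N predT = 1. Proof. by rewrite /lam cntT hlf_natr. Qed.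

Lemma lam_or N (P Q : pred (seq bool)) : lam N (fun t => P t || Q t) <= lam N P + lam N Q.
Proof.
rewrite /lam -mulrDl ler_pM2r ?hlf_gt0 // -natrD ler_nat /cnt -count_predUI.
exact: leq_addr.
Qed.

Lemma lam_split N (P Q : pred (seq bool)) :
  lam N P = lam N (fun t => P t && Q t) + lam N (fun t => P t && ~~ Q t).
Proof.
by rewrite /lam -mulrDl -natrD -cnt_split.
Qed.

Lemma lam_has N (I : Type) (K : seq I) (F : I -> pred (seq bool)) :
  lam N (fun t => has (fun k => F k t) K) <= \sum_(k <- K) lam N (F k).
Proof.
elim: K => [|k K IH] /=.
  by rewrite big_nil /lam /cnt (eq_count (a2 := pred0)) // count_pred0 mul0r.
by rewrite big_cons; apply: le_trans (lam_or _ _ _) _; rewrite lerD2l.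
Qed.

Lemma lam_has_le N (I : eqType) (K : seq I) (F : I -> pred (seq bool)) (c : rat) :
  (forall k, k \in K -> lam N (F k) <= c) ->
  lam N (fun t => has (fun k => F k t) K) <= (size K)%:R * c.
Proof.
move=> H; apply: le_trans (lam_has _ _ _) _.
elim: K H => [|k K IH] H; first by rewrite big_nil mul0r.
rewrite big_cons /= -addn1 natrD mulrDl mul1r addrC lerD ?H ?mem_head //.
by apply: IH => j Hj; rewrite H // inE Hj orbT.
Qed.

Lemma lam_cat N k (P Q : pred (seq bool)) :
  lam (N + k) (fun t => P (take N t) && Q (drop N t)) = lam N P * lam k Q.
Proof. by rewrite /lam cnt_cat natrM hlfD mulrACA. Qed.

Lemma lam_take N k (P : pred (seq bool)) : lam (N + k) (fun t => P (take N t)) = lam N P.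
Proof. by rewrite /lam cnt_take natrM hlfD mulrACA hlf_natr mulr1. Qed.

Lemma lam_drop N k (P : pred (seq bool)) : lam (N + k) (fun t => P (drop N t)) = lam k P.
Proof. by rewrite /lam cnt_drop natrM hlfD mulrACA hlf_natr mul1r. Qed.

(** Membership in the open set generated by [L], as far as [t] decides it: strings of [L] longer
    than [t] do not count. *)
Definition cov (L : seq nat) (t : seq bool) := has (fun n => prefix (str_of_nat n) t) L.

Lemma cov_cat L L' t : cov (L ++ L') t = cov L t || cov L' t.
Proof. exact: has_cat. Qed.

Lemma cov_sub L L' t : {subset L <= L'} -> cov L t -> cov L' t.
Proof. by move=> S /hasP[n /S Hn Hp]; apply/hasP; exists n. Qed.

Lemma cov_prefix L s t : prefix s t -> cov L s -> cov L t.
Proof.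
by move=> S /hasP[n Hn Hp]; apply/hasP; exists n => //; apply: prefix_trans S.
Qed.

Lemma prefix_take_size (T : eqType) (s t : seq T) N : (size s <= N)%N ->
  prefix s (take N t) = prefix s t.
Proof. by move=> H; rewrite !prefixE take_takel. Qed.

Lemma cov_take L N t : (forall n, n \in L -> size (str_of_nat n) <= N)%N ->
  cov L (take N t) = cov L t.
Proof. by move=> H; apply: eq_in_has => n /H Hn; rewrite prefix_take_size. Qed.

Lemma leq_exp2_hlf c m N : (c * 2 ^ m <= 2 ^ N)%N = (c%:R * hlf N <= hlf m).
Proof.
rewrite -(ler_nat rat) natrM !natr_exp2 ler_pdivrMr ?hlf_gt0 //.
by rewrite ler_pdivlMl ?hlf_gt0 // mulrC.
Qed.

Lemma measure_leP A e m : measure_le A e m <->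
  forall L N, (forall n, n \in L -> inWA A e n) -> lam N (cov L) <= hlf m.
Proof.
by split=> H L N HL; have := H L N HL; rewrite (card_tuples_cnt N (cov L)) leq_exp2_hlf.
Qed.

End Lam.

Section CompMeasure.
Context (A : nat -> bool) (X : Type) {EX : Enc X}.

Lemma comp_strs (f : X -> nat) : Acomputable A f -> Acomputable A (fun x => strs (f x)).
Proof. by move=> F; rewrite /strs; comp_tac. Qed.

Lemma comp_cov (L : X -> seq nat) (t : X -> seq bool) :
  Acomputable A L -> Acomputable A t -> Acomputable A (fun x => cov (L x) (t x)).
Proof. by move=> CL Ct; rewrite /cov; comp_tac. Qed.

Lemma comp_cnt (f : X -> nat) (P : X -> pred (seq bool)) :
  Acomputable A f -> Acomputable A (fun q : X * seq bool => P q.1 q.2) -> Acomputable A (fun x => cnt (f x) (P x)).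
Proof. by move=> F CP; rewrite /cnt; apply: comp_count => //; apply: comp_strs. Qed.
End CompMeasure.

Ltac comp_user8 := fail.
Ltac comp_user7 ::=
  lazymatch goal with
  | |- Acomputable _ (fun x => strs _) => apply: comp_strs
  | |- Acomputable _ (fun x => cov _ _) => apply: comp_cov
  | |- Acomputable _ (fun x => cnt _ _) => apply: comp_cnt
  | |- _ => comp_user8
  end.

(** * Rounded measure of the stages of a c.e. open set *)

Section StageMeasure.
Context (A : nat -> bool).

(* The measure of the stage-s approximation, rounded down to a multiple of 2^-q. *)
Definition mass q e s := (cnt s (cov (wlist A e s)) * 2 ^ q) %/ 2 ^ s.

Lemma size_wlist e s x : x \in wlist A e s -> size (str_of_nat x) <= s.
Proof. by move=> /wlist_lt H; have := size_str_le x; lia. Qed.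

Lemma cnt_wlist_ge e s k : cnt s (cov (wlist A e s)) * 2 ^ k <= cnt (s + k) (cov (wlist A e s)).
Proof.
by rewrite -cnt_take; apply: leq_cnt => t _; rewrite cov_take // => n /size_wlist.
Qed.

(** Each covered string of length [s] has two covered extensions, and the stages increase. *)
Lemma mass_mono q e s : mass q e s <= mass q e s.+1.
Proof.
rewrite /mass -(@divnMl 2) // -expnS; apply: leq_div2r.
rewrite mulnA leq_mul2r; apply/orP; right.
have := cnt_wlist_ge e s 1; rewrite addn1 expn1 mulnC => /leq_trans; apply.
by apply: leq_cnt => t _; apply: cov_sub; apply: wlist_mono.
Qed.

Lemma mass_le q e s : mass q e s <= 2 ^ q.
Proof.
rewrite /mass -ltnS ltn_divLR ?expn_gt0 //.
have : cnt s (cov (wlist A e s)) <= 2 ^ s by rewrite -(size_strs s) count_size.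
by have := expn_gt0 2 s; nia.
Qed.

Local Open Scope ring_scope.

(** Equal rounded masses put both measures into one interval of length 2^-q, and the earlier stage
    is contained in the later one, so the measure of the difference is the difference of the
    measures. *)
Lemma mass_gap q e s s' N : (s <= s')%N -> (s' <= N)%N -> mass q e s = mass q e s' ->
  lam N (fun t => cov (wlist A e s') t && ~~ cov (wlist A e s) t) <= hlf q.
Proof.
move=> Hs HN E.
rewrite -(subnKC HN) -(@eq_lam _ (fun t => cov (wlist A e s') (take s' t) && ~~ cov (wlist A e s) (take s' t))).
  2: by move=> t _; rewrite !cov_take // => n /size_wlist; lia.
rewrite (@lam_take s' _ (fun t => cov (wlist A e s') t && ~~ cov (wlist A e s) t)).
rewrite /lam -leq_exp2_hlf.
set x := cnt s' (cov (wlist A e s')); set z := cnt s' _.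
have Exz : (x = cnt s' (cov (wlist A e s)) + z)%N.
  rewrite /x (cnt_split _ _ (cov (wlist A e s))); congr (_ + _)%N; apply: eq_cnt => t _.
  apply/andP/idP => [[_ //]|H]; split=> //.
  by apply: cov_sub H; apply: wlist_mono.
have Hy := cnt_wlist_ge e s (s' - s); rewrite subnKC // in Hy.
have H1 := ltn_ceil (x * 2 ^ q) (expn_gt0 2 s'); rewrite -/(mass q e s') -E in H1.
have H2 := leq_divM (cnt s (cov (wlist A e s)) * 2 ^ q) (2 ^ s); rewrite -/(mass q e s) in H2.
have E2 : (2 ^ s' = 2 ^ s * 2 ^ (s' - s))%N by rewrite -expnD subnKC.
move: H1 H2 Hy; rewrite Exz E2.
set y := cnt s' _; set y0 := cnt s _; set M := mass q e s.
have := expn_gt0 2 (s' - s); set d := (2 ^ (s' - s))%N; set a := (2 ^ s)%N; set b := (2 ^ q)%N.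
move=> Hd H1 H2 Hy.
have H3 : (M * a * d <= y0 * b * d)%N by rewrite leq_mul2r H2 orbT.
have H4 : (y0 * d * b <= y * b)%N by rewrite leq_mul2r Hy orbT.
nia.
Qed.

End StageMeasure.

Local Open Scope ring_scope.
Import GRing.Theory Num.Theory Order.TTheory.

Lemma sum_hlf a k : \sum_(j <- iota a k) hlf j <= 2 * hlf a.
Proof.
suff -> : \sum_(j <- iota a k) hlf j = 2 * hlf a - 2 * hlf (a + k).
  by have := hlf_gt0 (a + k); lra.
elim: k a => [|k IH] a /=; first by rewrite big_nil addn0; lra.
by rewrite big_cons IH addSnnS (hlfS a); lra.
Qed.

Lemma natr_hlf a : a%:R * hlf a <= 1.
Proof.
have : a%:R * hlf a <= (2 ^ a)%:R * hlf a.
  by rewrite ler_pM2r ?hlf_gt0 // ler_nat; exact/ltnW/ltn_expl.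
by rewrite hlf_natr.
Qed.

Lemma lam_cov_level L N M : (forall n, n \in L -> size (str_of_nat n) <= N)%N ->
  (forall n, n \in L -> size (str_of_nat n) <= M)%N -> lam N (cov L) = lam M (cov L).
Proof.
wlog H : N M / (N <= M)%N.
  by move=> W HN HM; case/orP: (leq_total N M) => H; [|symmetry]; apply: W.
move=> HN _; rewrite -(subnKC H) -(@lam_take N (M - N)).
by apply: eq_lam => t _; rewrite cov_take.
Qed.

(** * Traceability implies lowness *)

Section Capture.
Context (A : nat -> bool) (h f : nat -> nat) (st : nat * nat -> nat).
Hypothesis h_mono : forall n m, (n <= m)%N -> (h n <= h m)%N.
Hypothesis f_measure : forall m, measure_le A (f m) m.
(** The summand [q] drives the stages to infinity with the precision, so every element of a
    component is eventually enumerated. *)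
Local Notation stage m q := (q + st (m, q))%N.
Hypothesis st_mass : forall m q s, (st (m, q) <= s)%N ->
  mass A q (f m) (q + s) = mass A q (f m) (stage m q).

(* [blk] and [prec] are chosen so that
   blk n * 2^-(prec n) + 2 * 2^-(blk n) <= 2^-(n + h n). *)
Definition blk n := (n + h n + 2)%N.
Arguments blk : simpl never.
Definition prec n := (2 * blk n)%N.

(* An entry (j, ((e, s), (e', s'))) describes the clopen set generated by the
   stage-s' approximation of index e', minus, when [j < a], the stage-s one of e. *)
Definition entry := (nat * ((nat * nat) * (nat * nat)))%type.
Definition in_entry (a : nat) (p : entry) (t : seq bool) : bool :=
  cov (wlist A p.2.2.1 p.2.2.2) t && ~~ ((p.1 < a)%N && cov (wlist A p.2.1.1 p.2.1.2) t).
Definition level (D : seq entry) := sumn [seq (p.2.1.2 + p.2.2.2)%N | p <- D].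
Definition piece_of n (D : seq entry) : seq nat :=
  [seq y <- iota (2 ^ level D).-1 (2 ^ level D) |
    has (fun p => in_entry (blk n) p (str_of_nat y)) D].
Definition bounds n m : entry :=
  (m, ((f m, stage m (prec n)), (f m, stage m (prec n.+1)))).
Definition data n := [seq bounds n m | m <- iota 0 (blk n.+1)].
Definition piece n := piece_of n (data n).

Lemma blk_mono n m : (n <= m)%N -> (blk n <= blk m)%N.
Proof. by move=> H; have := h_mono H; rewrite /blk; lia. Qed.

Lemma level_ge n m : (m < blk n.+1)%N ->
  (stage m (prec n) <= level (data n))%N /\ (stage m (prec n.+1) <= level (data n))%N.
Proof.
move=> Hm; have : (stage m (prec n) + stage m (prec n.+1) <= level (data n))%N.
  have Hi : m \in iota 0 (blk n.+1) by rewrite mem_iota.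
  by rewrite /level /data -map_comp sumnE big_map (big_rem m Hi) leq_addr.
by lia.
Qed.

Lemma piece_size n y : y \in piece n -> size (str_of_nat y) = level (data n).
Proof.
rewrite mem_filter => /andP[_ Hy]; apply/eqP; rewrite -mem_strs.
exact: map_f.
Qed.

Lemma cov_piece n t : size t = level (data n) ->
  cov (piece n) t = has (fun p => in_entry (blk n) p t) (data n).
Proof.
move=> Ht; apply/idP/idP.
  move=> /hasP[y Hy Hp]; have Es := piece_size Hy.
  move: Hp; rewrite prefixE Es -Ht take_size => /eqP ->.
  by move: Hy; rewrite mem_filter => /andP[].
move=> H; apply/hasP; exists (nat_of_str t); last by rewrite nat_of_strK prefix_refl.
rewrite mem_filter nat_of_strK H /=.
have : t \in strs (level (data n)) by rewrite mem_strs Ht.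
by move=> /mapP[y Hy ->]; rewrite str_of_natK.
Qed.

(** A component below [blk n] contributes the difference of two stages of almost equal mass, bounded
    by [mass_gap]. A component from [blk n] on enters in full, but these measures form a geometric
    tail. *)
Lemma piece_measure n N : (forall y, y \in piece n -> size (str_of_nat y) <= N)%N ->
  lam N (cov (piece n)) <= hlf (n + h n).
Proof.
move=> HN; rewrite (lam_cov_level HN (M := level (data n))); last by move=> y /piece_size ->.
rewrite (@eq_lam _ _ (fun t => has (fun m => in_entry (blk n) (bounds n m) t) (iota 0 (blk n.+1)))); last first.
  by move=> t /cov_piece ->; rewrite /data has_map.
set l := level (data n).
apply: le_trans (lam_has _ _ _) _.
have Hb := blk_mono (leqnSn n).
rewrite -(subnKC Hb) iotaD big_cat /= add0n.
apply: (@le_trans _ _ ((blk n)%:R * hlf (prec n) + 2 * hlf (blk n))).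
  apply: lerD; last first.
    apply: le_trans (sum_hlf _ (blk n.+1 - blk n)).
    rewrite big_seq [X in _ <= X]big_seq; apply: ler_sum => m; rewrite mem_iota => Hm.
    have /measure_leP H := @f_measure m.
    apply: le_trans (H (wlist A (f m) (stage m (prec n.+1))) l _); last by move=> x /wlist_inWA.
    by apply: le_lam => t _ /andP[].
  have -> : (blk n)%:R * hlf (prec n) = \sum_(m <- iota 0 (blk n)) hlf (prec n).
    by rewrite big_const_seq count_predT size_iota iter_addr_0 mulr_natl.
  rewrite big_seq [X in _ <= X]big_seq; apply: ler_sum => m; rewrite mem_iota add0n /= => Hm.
  have [H1 H2] : (stage m (prec n) <= l)%N /\ (stage m (prec n.+1) <= l)%N.
    by apply: level_ge; lia.
  have Hp : (prec n <= prec n.+1)%N by rewrite /prec; lia.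
  case: (leqP (stage m (prec n)) (stage m (prec n.+1))) => Hs.
    have G := @mass_gap A (prec n) (f m) _ _ l Hs H2.
    apply: le_trans (G _).
      by apply: le_lam => t _; rewrite /in_entry /= Hm.
    have E : (prec n + (stage m (prec n.+1) - prec n) = stage m (prec n.+1))%N by lia.
    rewrite -E [RHS]st_mass //.
    by rewrite -(leq_add2l (prec n)) E.
  (* The stage of the finer precision comes first here, so the difference is empty. *)
  apply: le_trans (hlf_ge0 _).
  rewrite -(@eq_lam _ pred0); first by rewrite /lam /cnt count_pred0 mul0r.
  move=> t _; rewrite /in_entry /= Hm /=; symmetry; apply/andP => -[H3 /negP]; apply.
  by apply: cov_sub H3; apply: wlist_mono; exact: ltnW.
(* With [b = blk n], the sum [b * 2^-(2b) + 2 * 2^-b] is at most [3 * 2^-b], and [4 * 2^-b] is the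
   bound wanted. *)
have -> : hlf (prec n) = hlf (blk n) * hlf (blk n) by rewrite -hlfD addnn -mul2n.
have := natr_hlf (blk n); have := hlf_gt0 (blk n).
have -> : hlf (n + h n) = 2 * (2 * hlf (blk n)) by rewrite /blk addn2 -!hlfS.
move=> H1 H2; rewrite mulrA.
have : (blk n)%:R * hlf (blk n) * hlf (blk n) <= 1 * hlf (blk n) by rewrite ler_pM2r.
by lra.
Qed.

Lemma piece_capture m Z M : (blk M <= m)%N -> in_open A (f m) Z ->
  exists2 n, (M <= n)%N & exists2 y, y \in piece n & is_prefix_of (str_of_nat y) Z.
Proof.
move=> HM [x [/inWA_wlist[n0 Hn0] Hx]].
pose C n N := (m < blk n)%N && cov (wlist A (f m) (stage m (prec n))) (mkseq Z N).
have pre N N' : (N <= N')%N -> prefix (mkseq Z N) (mkseq Z N').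
  by move=> H; rewrite prefixE size_mkseq /mkseq -map_take take_iota (minn_idPl H).
have CN n N N' : (stage m (prec n) <= N)%N -> (N <= N')%N -> C n N = C n N'.
  move=> H1 H2; rewrite /C; congr (_ && _).
  have -> : mkseq Z N = take N (mkseq Z N').
    by have := pre _ _ H2; rewrite prefixE size_mkseq => /eqP.
  by rewrite cov_take // => y /size_wlist; lia.
pose K n := C n (stage m (prec n)).
have K0 : ~~ K M by rewrite /K /C ltnNge HM.
have [n1 Hn1 K1] : exists2 n, (M <= n)%N & K n.
  exists (n0 + m + M + size (str_of_nat x))%N; first by lia.
  set n := (n0 + m + M + _)%N; rewrite /K /C; apply/andP; split; first by rewrite /blk; lia.
  apply/hasP; exists x; first by apply: Hn0; rewrite /prec /blk; lia.
  by rewrite Hx; apply: pre; rewrite /n /prec /blk; lia.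
have [n Hn] : exists2 n, (M <= n)%N & ~~ K n && K n.+1.
  rewrite -(subnKC Hn1) in K1.
  elim: (n1 - M)%N K1 => [|d IH]; first by rewrite addn0 (negbTE K0).
  case E: (K (M + d)%N); first by move=> _; apply: IH.
  by rewrite addnS => K1; exists (M + d)%N; [apply: leq_addr|rewrite E K1].
move=> /andP[Kn Kn1]; exists n => //.
have Hm : (m < blk n.+1)%N by case/andP: Kn1.
have [L1 L2] := level_ge Hm.
pose t := mkseq Z (level (data n)).
have : cov (piece n) t.
  rewrite cov_piece ?size_mkseq //; apply/hasP; exists (bounds n m).
    by apply/map_f; rewrite mem_iota.
  rewrite /K (@CN n _ _ (leqnn _) L1) in Kn.
  rewrite /K (@CN n.+1 _ _ (leqnn _) L2) in Kn1.
  by case/andP: Kn1 => _ Kn1; rewrite /in_entry /= Kn1.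
move=> /hasP[y Hy Hp]; exists y => //.
move: Hp; rewrite prefixE (piece_size Hy) take_oversize ?size_mkseq // => /eqP <-.
by rewrite /is_prefix_of size_mkseq.
Qed.

(** The number of entries and their precisions depend on [h] alone, hence need no oracle, as
    [oce_list] and [oce_reindex] require; the final evaluation of the entries may consult [A]. *)
Lemma oce_piece : Acomputable emptyset h ->
  oce A (fun x : nat * nat => (f x.1, st x)) -> oce A (fun n => enc (piece n)).
Proof.
move=> Ch O.
have CB : Acomputable emptyset blk by rewrite /blk; comp_tac.
have CP : Acomputable emptyset prec by rewrite /prec; comp_tac.
have O1 : oce A (fun x : nat * nat => (f x.2, st (x.2, prec x.1))).
  by apply: (oce_reindex (c := fun x : nat * nat => (x.2, prec x.1)) O); comp_tac.
have O2 : oce A (fun x : nat * nat => (f x.2, st (x.2, prec x.1.+1))).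
  by apply: (oce_reindex (c := fun x : nat * nat => (x.2, prec x.1.+1)) O); comp_tac.
have O3 : oce A (fun x : nat * nat => bounds x.1 x.2).
  have CP' := comp_lift A CP.
  apply: (oce_comp (p := fun (x : nat * nat) (v : (nat * nat) * (nat * nat)) =>
    (x.2, ((v.1.1, prec x.1 + v.1.2)%N, (v.2.1, prec x.1.+1 + v.2.2)%N))) (oce_pair O1 O2)).
  by comp_tac.
have O4 : oce A data.
  by apply: (oce_list (idx := fun n m => (n, m)) (c := fun n => blk n.+1) O3); comp_tac.
have CB' := comp_lift A CB.
apply: (oce_comp (p := fun n D => enc (piece_of n D)) O4).
by rewrite /piece_of /level /in_entry; comp_tac.
Qed.

End Capture.

Definition declist (k : nat) : seq nat := dec (seq nat) k.
(** The resolution [sumn L] is at least the length of each string in [L], so the measure is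
    exact. *)
Definition small h n (L : seq nat) := (cnt (sumn L) (cov L) * 2 ^ (n + h n) <= 2 ^ (sumn L))%N.
(** A trace may contain lists other than the piece; those of too large measure are filtered out
    before the union is formed. *)
Definition captured (h : nat -> nat) (v : nat * nat) (y s : nat) :=
  has (fun k => (y \in declist k) && small h v.1 (declist k)) (wlist emptyset v.2 s).

Lemma traceable_low A : BLR_traceable A -> low_for_Demuth_BLR A.
Proof.
move=> [h [[/A_computableP Ch h_mono _] tr]] Z HZ f /omega_ce_byP Of Hf.
have O1 : oce A (fun x : nat * nat => f x.1).
  by apply: (oce_reindex (c := fun x : nat * nat => x.1) Of); comp_tac.
have Cmu : Acomputable A (fun q : (nat * nat) * (nat * nat) => mass A q.1.2 q.2.1 (q.1.2 + q.2.2)).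
  by rewrite /mass; comp_tac.
have CB : Acomputable emptyset (fun x : nat * nat => (2 ^ x.2)%N) by comp_tac.
have mono (x : nat * nat) e s : (mass A x.2 e (x.2 + s) <= mass A x.2 e (x.2 + s.+1))%N.
  by rewrite addnS; apply: mass_mono.
have [st [O2 Hst]] := oce_stage O1 Cmu CB mono (fun x e s => mass_le A x.2 e (x.2 + s)).
have st_mass m q s : (st (m, q) <= s)%N -> mass A q (f m) (q + s) = mass A q (f m) (q + st (m, q)).
  exact: Hst (m, q) s.
have Op := oce_piece Ch O2.
have [r [/omega_ce_byP Or Hr1 Hr2]] := tr _ ((omega_ce_byP _ _).2 Op).
have CV : Acomputable emptyset (fun q : (nat * nat) * (nat * nat) => captured h q.1 q.2.1 q.2.2).
  by rewrite /captured /small /declist; comp_tac.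
have [R CR HR] := enumeration CV.
pose rho n := R (n, r n).
have Orho : omega_ce_by emptyset rho.
  apply/omega_ce_byP; apply: (oce_comp (p := fun n e => R (n, e)) Or).
  by have := CR emptyset => CR'; comp_tac.
have inV n y : inW (rho n) y <-> exists2 k, inW (r n) k &
    (y \in declist k) && small h n (declist k).
  rewrite /inW HR; split=> [[s /hasP[k /wlist_inWA Hk Hy]]|[k /inWA_wlist[s Hs] Hy]].
    by exists k.
  by exists s; apply/hasP; exists k => //; apply: Hs.
have smallP L n : small h n L -> forall N, (forall y, y \in L -> size (str_of_nat y) <= N)%N ->
    lam N (cov L) <= hlf (n + h n).
  rewrite /small leq_exp2_hlf -/(lam _ _) => HL N HN.
  rewrite (lam_cov_level HN (M := sumn L)) // => y Hy.
  apply: leq_trans (size_str_le y) _.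
  by rewrite sumnE (big_rem y) //= leq_addr.
have Hrho n : measure_le emptyset (rho n) n.
  apply/measure_leP => L N HL.
  (* Finitely many elements of the trace account for [L]; being distinct, they number at most
     [h n]. *)
  have [K [uK HK HLK]] : exists K, [/\ uniq K, forall k, k \in K -> inW (r n) k /\ small h n (declist k) &
      forall y, y \in L -> exists2 k, k \in K & y \in declist k].
    elim: L HL => [|y L IH] HL; first by exists [::].
    have [K [uK HK HLK]] := IH (fun x Hx => HL x (mem_behead (s := y :: L) Hx)).
    have [k Hk /andP[Hy Hs]] := (inV n y).1 (HL y (mem_head _ _)).
    case E: (k \in K).
      exists K; split=> // x; rewrite inE => /orP[/eqP -> |/HLK //].
      by exists k.
    exists (k :: K); split; first by rewrite /= E.
      by move=> x; rewrite inE => /orP[/eqP -> |/HK //].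
    move=> x; rewrite inE => /orP[/eqP -> |/HLK[k' Hk' Hx]]; first by exists k; rewrite ?mem_head.
    by exists k'; rewrite // inE Hk' orbT.
  have sK : (size K <= h n)%N by apply: Hr1 => // k /HK[].
  (* Strings longer than [N] cover nothing at resolution [N]. Once they are dropped, the resolution
     can be raised to where [small] applies. *)
  apply: (@le_trans _ _ (lam N (fun t => has (fun k => cov [seq y <- declist k | (size (str_of_nat y) <= N)%N] t) K))).
    apply: le_lam => t Ht /hasP[y /HLK[k Hk Hy] Hp]; apply/hasP; exists k => //.
    apply/hasP; exists y => //; rewrite mem_filter Hy andbT -Ht.
    by move/prefixP: Hp => [u ->]; rewrite size_cat leq_addr.
  apply: le_trans (lam_has_le (c := hlf (n + h n)) _) _.
    move=> k /HK[_ Hs].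
    have [N' HN'] : exists N', (forall y, y \in declist k -> size (str_of_nat y) <= N')%N.
      exists (sumn (declist k)) => y Hy.
      apply: leq_trans (size_str_le y) _.
      by rewrite sumnE (big_rem y) //= leq_addr.
    rewrite (@lam_cov_level _ N (N + N')); first last.
    - by move=> y; rewrite mem_filter => /andP[Hy _]; lia.
    - by move=> y; rewrite mem_filter => /andP[].
    apply: le_trans (smallP _ _ Hs (N + N')%N _); last by move=> y /HN'; lia.
    apply: le_lam => t _; apply: cov_sub => y; by rewrite mem_filter => /andP[].
  (* Here [h n] sets of measure 2^-(n + h n) are joined, and [a * 2^-a] is at most 1. *)
  rewrite hlfD mulrCA -[leRHS]mulr1 ler_pM2l ?hlf_gt0 //.
  apply: le_trans (natr_hlf (h n)); by rewrite ler_pM2r ?hlf_gt0 // ler_nat.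
have [M HM] := HZ rho Orho Hrho.
exists (blk h M) => m Hm Hin.
have [n Hn [y Hy Hp]] := piece_capture st Hm Hin.
apply: (HM n Hn); exists y; split=> //; apply/inV.
exists (enc (piece A h f st n)); first exact: Hr2.
rewrite /declist encK Hy /= /small leq_exp2_hlf.
apply: (piece_measure h_mono Hf st_mass) => x Hx.
apply: leq_trans (size_str_le x) _.
by rewrite sumnE (big_rem x) //= leq_addr.
Qed.

(** * Independent block sets *)

(* The clopen sets of measure 2^-n: for fixed n they sit on disjoint blocks of
   positions for different k, hence are independent. *)
Definition zero_block (n k : nat) (t : seq bool) : bool :=
  take n (drop (n * k.+1) t) == nseq n false.

Lemma zero_block_size n k t : zero_block n k t -> (0 < n)%N -> (n * k.+2 <= size t)%N.
Proof.
move=> /eqP/(congr1 size); rewrite size_nseq size_take size_drop.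
by rewrite (mulnS n k.+1); set x := size t; case: ltnP; lia.
Qed.

Lemma zero_block_take n k N t : (n * k.+2 <= N)%N -> zero_block n k (take N t) = zero_block n k t.
Proof.
move=> H; rewrite /zero_block.
rewrite (mulnS n k.+1) in H.
have -> : N = (N - n * k.+1 + n * k.+1)%N by lia.
by rewrite -take_drop take_takel //; lia.
Qed.

Lemma zero_block_prefix n k s t : prefix s t -> zero_block n k s -> zero_block n k t.
Proof.
move=> /prefixP[u ->]; case: n => [|n] H; first by rewrite /zero_block !take0.
have := zero_block_size H (ltn0Sn _) => Hs.
by rewrite -(zero_block_take _ Hs) take_size_cat.
Qed.

Lemma cnt_pred1 s : cnt (size s) (pred1 s) = 1%N.
Proof. by rewrite /cnt count_uniq_mem ?uniq_strs // mem_strs eqxx. Qed.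

Lemma lam_nseq n : lam n (pred1 (nseq n false)) = hlf n.
Proof.
by have := cnt_pred1 (nseq n false); rewrite size_nseq /lam => ->; rewrite mul1r.
Qed.

Lemma lam_zero_block n k N : lam N (zero_block n k) <= hlf n.
Proof.
case: (leqP (n * k.+2) N) => [H|H].
  have -> : N = (n * k.+1 + (n + (N - n * k.+2)))%N by rewrite (mulnS n k.+1) in H *; lia.
  rewrite (@lam_drop _ _ (fun u => take n u == nseq n false)).
  by rewrite (@lam_take _ _ (pred1 (nseq n false))) lam_nseq.
apply: le_trans (hlf_ge0 n).
rewrite (@eq_lam _ _ pred0) ?/lam ?/cnt ?count_pred0 ?mul0r // => t Ht.
by apply/negP => Hz; have := zero_block_size Hz; rewrite Ht; case: (n) H => [|m]; lia.
Qed.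

(** Induction on the number of blocks: by [lam_cat] the last block is independent of the positions
    before it and contributes its own factor. *)
Lemma lam_avoid_blocks n B (K : pred nat) N : (n * B.+1 <= N)%N ->
  lam N (fun t => all (fun k => K k ==> ~~ zero_block n k t) (iota 0 B)) =
  (1 - hlf n) ^+ count K (iota 0 B).
Proof.
move=> HN.
have T b t : all (fun k => K k ==> ~~ zero_block n k (take (n * b.+1) t)) (iota 0 b) =
             all (fun k => K k ==> ~~ zero_block n k t) (iota 0 b).
  by apply: eq_in_all => k; rewrite mem_iota => Hk; rewrite zero_block_take // leq_mul2l; lia.
rewrite -(subnKC HN) -(@eq_lam _ _ _ (fun t _ => T B t)).
rewrite (@lam_take _ _ (fun t => all (fun k => K k ==> ~~ zero_block n k t) (iota 0 B))).
elim: B {HN} => [|b IH]; first by rewrite expr0 -[RHS](lamT (n * 1)); apply: eq_lam.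
have -> : (n * b.+2 = n * b.+1 + n)%N by rewrite (mulnS n b.+1) addnC.
rewrite (_ : iota 0 b.+1 = iota 0 b ++ [:: b]); last by rewrite -[in LHS]addn1 iotaD.
rewrite count_cat exprD -IH /= addn0.
have -> : (1 - hlf n) ^+ K b = lam n (fun u => K b ==> (u != nseq n false)).
  case: (K b) => /=; last by rewrite expr0 -(lamT n); apply: eq_lam.
  have := lam_split n predT (pred1 (nseq n false)); rewrite lamT.
  by rewrite (@eq_lam _ _ (pred1 (nseq n false))) // lam_nseq expr1 => ->; rewrite addrAC subrr add0r.
rewrite -lam_cat; apply: eq_lam => t Ht.
rewrite all_cat T /= andbT; congr (_ && (_ ==> ~~ _)).
rewrite /zero_block take_oversize //.
by rewrite size_drop Ht; lia.
Qed.

(** With [x = 2^-n] and [m = 2^n], Bernoulli's inequality gives (1 + x)^m at least 2, while (1 -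
    x)^m (1 + x)^m is at most 1. *)
Lemma half_pow n : (1 - hlf n) ^+ (2 ^ n) <= hlf 1.
Proof.
set x := hlf n; set m := (2 ^ n)%N.
have Hx0 := hlf_gt0 n; rewrite -/x in Hx0.
have Hx1 : x <= 1 by rewrite -hlf0; apply: hlf_le.
have H1 : 1 + m%:R * x <= (1 + x) ^+ m.
  elim: (m) => [|j IH]; first by rewrite expr0 mul0r addr0.
  rewrite exprS -addn1 natrD; have : 0 <= j%:R :> rat by [].
  by nra.
have H2 : (1 - x) ^+ m * (1 + x) ^+ m <= 1.
  by rewrite -exprMn; apply: exprn_ile1; nra.
rewrite hlf_natr in H1.
have H3 : 0 <= (1 - x) ^+ m by apply: exprn_ge0; lra.
have := hlfS 0; rewrite hlf0; nra.
Qed.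

(** The 4^n factors form 2^n groups of 2^n, each worth at most one half. *)
Lemma avoid_bound n : (1 - hlf n) ^+ (4 ^ n) <= hlf n.
Proof.
have -> : (4 ^ n = 2 ^ n * 2 ^ n)%N by rewrite -expnMn.
rewrite exprM; apply: (@le_trans _ _ (hlf 1 ^+ (2 ^ n))).
  apply: lerXn2r; rewrite ?nnegrE ?hlf_ge0 ?half_pow // exprn_ge0 //.
  by rewrite subr_ge0 -hlf0; apply: hlf_le.
have -> : hlf 1 ^+ (2 ^ n) = hlf (2 ^ n) by rewrite /hlf expr1 exprVn.
by apply: hlf_le; apply/ltnW/ltn_expl.
Qed.

Lemma lam_avoid n (K : seq nat) N : uniq K -> (forall k, k \in K -> n * k.+2 <= N)%N ->
  (n <= N)%N ->
  lam N (fun t => ~~ has (fun k => zero_block n k t) K) = (1 - hlf n) ^+ size K.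
Proof.
move=> uK HK Hn.
have [B HB HBN] : exists2 B, (forall k, k \in K -> k < B)%N & (n * B.+1 <= N)%N.
  elim: K {uK} HK => [|k K IH] HK; first by exists 0%N; rewrite ?muln1.
  have [B H1 H2] := IH (fun j Hj => HK j (mem_behead (s := k :: K) Hj)).
  have Hk := HK k (mem_head _ _).
  exists (maxn B k.+1); last by rewrite /maxn; case: ifP.
  by move=> j; rewrite inE => /orP[/eqP ->|/H1]; lia.
rewrite (@eq_lam _ _ (fun t => all (fun k => (k \in K) ==> ~~ zero_block n k t) (iota 0 B))); last first.
  move=> t _; apply/hasPn/allP => [H k _|H k Hk]; first by apply/implyP => /H.
  by have := H k; rewrite mem_iota Hk /= add0n => /(_ (HB _ Hk)).
rewrite lam_avoid_blocks //; congr (_ ^+ _).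
rewrite -size_filter; apply/perm_size/uniq_perm => //; first by rewrite filter_uniq ?iota_uniq.
by move=> k; rewrite mem_filter mem_iota; case E: (k \in K) => //=; rewrite HB.
Qed.

Section CompZeroBlock.
Context (A : nat -> bool) (X : Type) {EX : Enc X}.

Lemma comp_zero_block (f g : X -> nat) (t : X -> seq bool) : Acomputable A f -> Acomputable A g -> Acomputable A t ->
  Acomputable A (fun x => zero_block (f x) (g x) (t x)).
Proof.
move=> F G Ct.
apply: (comp_ext (f := fun x => take (f x) (iter (f x * (g x).+1) behead (t x)) ==
   [seq false | i <- iota 0 (f x)])) => [x|].
  rewrite /zero_block iter_behead; congr (_ == _).
  by elim: (f x) 0%N => //= n IH a; rewrite IH.
by comp_tac.
Qed.

Lemma comp_flatten (T : Type) {ET : Enc T} (s : X -> seq (seq T)) :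
  Acomputable A s -> Acomputable A (fun x => flatten (s x)).
Proof. by move=> S; rewrite /flatten; comp_tac. Qed.
End CompZeroBlock.

Ltac comp_user8 ::=
  lazymatch goal with
  | |- Acomputable _ (fun x => zero_block _ _ _) => apply: comp_zero_block
  | |- Acomputable _ (fun x => flatten _) => apply: comp_flatten
  end.

Lemma oce_const A (T : Type) (U : eqType) {ET : Enc T} {EU : Enc U} (a : U) :
  oce A (fun _ : T => a).
Proof.
exists (fun _ _ => a), (fun _ => 0%N); split; try by comp_tac.
- by move=> x; exists 0%N.
- by move=> x; elim=> // n IH; rewrite changesS eqxx addn0.
Qed.

(** * Traces from a cover of the block sets *)

(** This expresses that the cone of [s] minus the open set generated by [U] has measure at least
    2^-d, through the finite parts of [U]. *)
Definition large (s : seq bool) (U : nat -> Prop) (d : nat) :=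
  forall L N, (size s <= N)%N -> (forall x, x \in L -> U x) ->
    hlf d <= lam N (fun t => prefix s t && ~~ cov L t).

(* A set of strings graded by levels; [v l] lists indices of c.e. sets of strings. *)
Definition at_level (v : nat -> seq nat) (l x : nat) := exists2 e, e \in v l & inW e x.
Definition at_some_level (v : nat -> seq nat) (x : nat) := exists l, at_level v l x.
(** The factor [C] will grow by 2 with each banned test, since the levels of one test from [G] on
    weigh at most [2 * 2^-G]. *)
Definition tails_le (v : nat -> seq nat) (C : nat) := forall G L N,
  (forall x, x \in L -> exists2 l, (G <= l)%N & at_level v l x) ->
  lam N (cov L) <= C%:R * hlf G.

Lemma split_list (T : eqType) (P Q : T -> Prop) (L : seq T) :
  (forall x, x \in L -> P x \/ Q x) ->
  exists L1 L2, [/\ forall x, x \in L1 -> P x, forall x, x \in L2 -> Q x &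
    {subset L <= L1 ++ L2}].
Proof.
elim: L => [|x L IH] H; first by exists [::], [::].
have [L1 [L2 [H1 H2 S]]] := IH (fun y Hy => H y (mem_behead (s := x :: L) Hy)).
case: (H x (mem_head _ _)) => Hx.
  exists (x :: L1), L2; split=> // y; first by rewrite inE => /orP[/eqP -> //|/H1].
  by rewrite /= !inE => /orP[->//|/S ->]; rewrite orbT.
exists L1, (x :: L2); split=> // y; first by rewrite inE => /orP[/eqP -> //|/H2].
by rewrite mem_cat !inE => /orP[->|/S]; rewrite ?orbT // mem_cat => /orP[] ->; rewrite ?orbT.
Qed.

Lemma lam_uncov N (P : pred (seq bool)) L L1 L2 : {subset L <= L1 ++ L2} ->
  lam N (fun t => P t && ~~ cov L1 t) <=
  lam N (fun t => P t && ~~ cov L t) + lam N (cov L2).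
Proof.
move=> S; apply: le_trans (lam_or _ _ _); apply: le_lam => t _ /andP[Pt N1].
case E: (cov L t) => /=; last by rewrite Pt.
by have := cov_sub S E; rewrite cov_cat (negbTE N1) => /= ->; rewrite orbT.
Qed.

Lemma lam_uncov_mono (P : pred (seq bool)) L L' N N' : (N <= N')%N -> {subset L <= L'} ->
  (forall t, size t = N' -> P t -> P (take N t)) ->
  lam N' (fun t => P t && ~~ cov L' t) <= lam N (fun t => P t && ~~ cov L t).
Proof.
move=> HN S HP; rewrite -[leRHS](@lam_take N (N' - N)) subnKC //.
apply: le_lam => t Ht /andP[/(HP _ Ht) -> /=]; apply: contra => /(cov_sub S).
by apply: cov_prefix; rewrite -{2}(cat_take_drop N t) prefix_prefix.
Qed.

Section Trace.
Context (f : nat -> nat) (s0 : seq bool) (v : nat -> seq nat) (C d i : nat).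
Hypothesis v_oce : oce emptyset v.
Hypothesis v_tails : tails_le v C.
Hypothesis v_large : large s0 (at_some_level v) d.
Hypothesis stuck : forall n t d', (i <= n)%N -> prefix s0 t -> zero_block n (f n) t ->
  ~ large t (at_some_level v) d'.

(** No string [t] of length [l] in the block set below [s0] is large, so a finite list covers its
    cone up to 2^-(c + l). There are at most 2^l such strings, and the finite lists are joined. *)
Lemma stuck_cover n c : (i <= n)%N -> exists L N0,
  [/\ forall x, x \in L -> at_some_level v x, (n * (f n).+2 + size s0 <= N0)%N &
      forall N, (N0 <= N)%N ->
        lam N (fun t => prefix s0 t && zero_block n (f n) t && ~~ cov L t) <= hlf c].
Proof.
move=> Hn; pose l := (n * (f n).+2 + size s0)%N.
pose good t := prefix s0 t && zero_block n (f n) t.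
have [L [N0 [HL HN0 H]]] : exists L N0,
  [/\ forall x, x \in L -> at_some_level v x, (l <= N0)%N &
      forall t, t \in strs l -> good t -> forall N, (N0 <= N)%N ->
        lam N (fun u => prefix t u && ~~ cov L u) <= hlf (c + l)].
  have : {subset strs l <= strs l} by [].
  elim: {1 3}(strs l) => [|t ts IH] Hs; first by exists [::], l.
  have [L [N0 [HL HN0 H]]] := IH (fun y Hy => Hs y (mem_behead (s := t :: ts) Hy)).
  case Eg: (good t); last first.
    by exists L, N0; split=> // y; rewrite inE => /orP[/eqP ->|/H //]; rewrite Eg.
  have [Hp Hz] := andP Eg.
  have [L1 [N1 [H1 H2 H3]]] : exists L1 N1, [/\ (size t <= N1)%N, (forall x, x \in L1 -> at_some_level v x) &
      lam N1 (fun u => prefix t u && ~~ cov L1 u) <= hlf (c + l)].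
    apply: NNPP => Hno; apply: (@stuck n t (c + l) Hn Hp Hz) => L1 N1 H1 H2.
    rewrite leNgt; apply/negP => Hlt; apply: Hno; exists L1, N1; split=> //; exact: ltW.
  exists (L1 ++ L), (maxn N0 N1); split.
  - by move=> x; rewrite mem_cat => /orP[/H2|/HL].
  - by rewrite leq_max HN0.
  move=> y; rewrite inE => Hy Hg N; rewrite geq_max => /andP[HN HN1].
  have sizey : size y = l.
    by apply/eqP; rewrite -mem_strs; apply: Hs; rewrite inE.
  have mono L' N' : (size y <= N')%N -> (N' <= N)%N -> {subset L' <= L1 ++ L} ->
    lam N (fun u => prefix y u && ~~ cov (L1 ++ L) u) <= lam N' (fun u => prefix y u && ~~ cov L' u).
    move=> Hs1 Hs2 S; apply: lam_uncov_mono => // u _; by rewrite prefix_take_size.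
  case/orP: Hy => [/eqP E|Hy].
    rewrite E in mono *; apply: le_trans H3; apply: mono => // x Hx.
    by rewrite mem_cat Hx.
  apply: le_trans (H y Hy Hg N0 (leqnn _)); apply: mono => //; first by rewrite sizey.
  by move=> x Hx; rewrite mem_cat Hx orbT.
exists L, N0; split=> // N HN.
apply: (@le_trans _ _ (lam N (fun u => has (fun t => prefix t u && ~~ cov L u) [seq t <- strs l | good t]))).
  apply: le_lam => u Hu /andP[/andP[Hp Hz] HnL]; apply/hasP; exists (take l u).
    have Hl : (l <= size u)%N by rewrite Hu; apply: leq_trans HN.
    rewrite mem_filter mem_strs size_takel // eqxx andbT /good.
    rewrite zero_block_take ?prefix_take_size ?Hp ?Hz //; first exact: leq_addl.
    by apply: leq_trans (leq_addr _ _); rewrite leqnn.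
  by rewrite HnL andbT -{2}(cat_take_drop l u) prefix_prefix.
apply: le_trans (lam_has_le (c := hlf (c + l)) _) _.
  by move=> t; rewrite mem_filter => /andP[Hg Ht]; apply: H.
rewrite hlfD mulrCA -[leRHS]mulr1 ler_pM2l ?hlf_gt0 //.
apply: (@le_trans _ _ ((2 ^ l)%:R * hlf l)); last by rewrite hlf_natr.
by rewrite ler_pM2r ?hlf_gt0 // ler_nat -(size_strs l) size_filter count_size.
Qed.

(* 4^n * 2^-(cover_prec n) = 2^-(d+3), and the levels beyond [cut n] weigh at most half
   of 2^-(cover_prec n). *)
Definition cover_prec n := (2 * n + d + 3)%N.
Definition cut n := (cover_prec n + 1 + C)%N.
Definition sample (D : seq nat) s : seq nat := flatten [seq wlist emptyset e s | e <- D].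
(** Cutting at a computable level leaves finitely many values of [v], so the list of them is again
    omega-c.e. *)
Definition indices n := flatten [seq v l | l <- iota 0 (cut n)].
(** The index list is an argument, so that the trace has an index computable from [n] and
    [indices n]. *)
Definition tested (x : nat * seq nat) (k s : nat) : bool :=
  [&& (x.1 * k.+2 <= s)%N, (size s0 <= s)%N &
   (cnt s (fun t => prefix s0 t && zero_block x.1 k t && ~~ cov (sample x.2 s) t) * 2 ^ cover_prec x.1 <= 2 ^ s)%N].

Lemma comp_tested : Acomputable emptyset (fun q : (nat * seq nat) * (nat * nat) => tested q.1 q.2.1 q.2.2).
Proof. by rewrite /tested /cover_prec /sample; comp_tac. Qed.

Lemma sample_mono D s s' : (s <= s')%N -> {subset sample D s <= sample D s'}.
Proof.
move=> H x /flattenP[L /mapP[e He ->] Hx]; apply/flattenP; exists (wlist emptyset e s').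
  by apply: map_f.
exact: wlist_mono Hx.
Qed.

Lemma sample_union n s x : x \in sample (indices n) s -> at_some_level v x.
Proof.
move=> /flattenP[L /mapP[e /flattenP[D /mapP[l _ ->] He] ->] /wlist_inWA Hx].
by exists l, e.
Qed.

Lemma sample_complete n (L : seq nat) :
  (forall x, x \in L -> exists2 l, (l < cut n)%N & at_level v l x) ->
  exists s, forall s', (s <= s')%N -> {subset L <= sample (indices n) s'}.
Proof.
elim: L => [|x L IH] H; first by exists 0%N.
have [s Hs] := IH (fun y Hy => H y (mem_behead (s := x :: L) Hy)).
have [l Hl [e He /inWA_wlist[s1 Hs1]]] := H x (mem_head _ _).
exists (maxn s s1) => s'; rewrite geq_max => /andP[H1 H2] y; rewrite inE => /orP[/eqP ->|Hy].
  apply/flattenP; exists (wlist emptyset e s'); last exact: Hs1.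
  apply: map_f; apply/flattenP; exists (v l) => //.
  by apply: map_f; rewrite mem_iota.
exact: Hs.
Qed.

(** [stuck_cover] is used with half the allowed error; giving up the strings of levels from [cut n]
    on costs at most the other half. *)
Lemma tested_self n : (i <= n)%N -> exists s, tested (n, indices n) (f n) s.
Proof.
move=> Hn; have [L [N0 [HL HN0 H]]] := stuck_cover (cover_prec n + 1) Hn.
have [L1 [L2 [H1 H2 S]]] := split_list (P := fun x => exists2 l, (l < cut n)%N & at_level v l x)
    (Q := fun x => exists2 l, (cut n <= l)%N & at_level v l x) (L := L)
    ltac:(by move=> x /HL[l Hl]; case: (ltnP l (cut n)) => Hc; [left|right]; exists l).
have [s Hs] := sample_complete H1.
exists (maxn N0 s); set N := maxn N0 s.
have HN : (N0 <= N)%N by apply: leq_maxl.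
apply/and3P; split=> /=; [by lia|by lia|].
rewrite leq_exp2_hlf -/(lam _ _).
apply: (@le_trans _ _ (lam N (fun t => prefix s0 t && zero_block n (f n) t && ~~ cov L1 t))).
  apply: le_lam => t _ /andP[->] /=; apply: contra; apply: cov_sub; apply: Hs; exact: leq_maxr.
apply: le_trans (lam_uncov _ _ S) _.
have -> : hlf (cover_prec n) = hlf (cover_prec n + 1) + hlf (cover_prec n + 1) by rewrite addn1 [LHS]hlfS; ring.
apply: lerD; first exact: H.
apply: le_trans (v_tails N H2) _.
rewrite /cut hlfD mulrCA -[leRHS]mulr1 ler_pM2l ?hlf_gt0 //; exact: natr_hlf.
Qed.

(** Given 4^n tested values, the strings in none of their block sets have measure at most 2^-n,
    which is at most 2^-(d+2). The uncovered strings below [s0] inside one of them have measure at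
    most 4^n 2^-(2n+d+3) = 2^-(d+3). Together this is less than the 2^-d that [v_large] leaves
    uncovered. *)
Lemma tested_card n (K : seq nat) : (d + 2 <= n)%N -> uniq K ->
  (forall k, k \in K -> exists s, tested (n, indices n) k s) -> (size K <= 4 ^ n)%N.
Proof.
move=> Hn uK HK; rewrite leqNgt; apply/negP => Hsize.
pose K' := take (4 ^ n) K.
have sK : size K' = (4 ^ n)%N by rewrite size_takel // ltnW.
have uK' : uniq K' by apply: take_uniq.
have {}HK k : k \in K' -> exists s, tested (n, indices n) k s by move=> /mem_take; apply: HK.
have [N [HN1 HN2 HN]] : exists N, [/\ (n <= N)%N, (size s0 <= N)%N &
    forall k, k \in K' -> exists2 s, (s <= N)%N & tested (n, indices n) k s].
  elim: (K') HK => [|k l IH] HK; first by exists (n + size s0)%N; split=> //; lia.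
  have [N [HN1 HN2 HN]] := IH (fun y Hy => HK y (mem_behead (s := k :: l) Hy)).
  have [s Hs] := HK k (mem_head _ _); exists (maxn N s); split; [by lia|by lia|].
  move=> y; rewrite inE => /orP[/eqP ->|/HN[s' Hs' T]]; first by exists s => //; exact: leq_maxr.
  by exists s' => //; lia.
have := v_large (L := sample (indices n) N) HN2 (@sample_union n N).
apply/negP; rewrite -ltNge.
apply: (@le_lt_trans _ _ (lam N (fun t => ~~ has (fun k => zero_block n k t) K') +
   lam N (fun t => has (fun k => prefix s0 t && zero_block n k t && ~~ cov (sample (indices n) N) t) K'))).
  apply: le_trans (lam_or _ _ _); apply: le_lam => t _ /andP[-> ->] /=.
  rewrite (@eq_has _ _ (fun k => zero_block n k t)); last by move=> k /=; rewrite andbT.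
  exact: orNb.
rewrite lam_avoid //; last first.
  by move=> k /HN[s Hs /and3P[H _ _]]; apply: leq_trans Hs.
have Hb := avoid_bound n; rewrite sK.
have Hc : lam N (fun t => has (fun k => prefix s0 t && zero_block n k t && ~~ cov (sample (indices n) N) t) K')
    <= (4 ^ n)%:R * hlf (cover_prec n).
  rewrite -sK; apply: lam_has_le => k /HN[s Hs /and3P[/= Hk1 Hk2 Hk3]].
  rewrite leq_exp2_hlf -/(lam _ _) in Hk3; apply: le_trans Hk3.
  apply: (lam_uncov_mono (P := fun t => prefix s0 t && zero_block n k t)) => //.
    exact: sample_mono.
  by move=> t _; rewrite zero_block_take // prefix_take_size.
have E : (4 ^ n)%:R * hlf (cover_prec n) = hlf (d + 3).
  have E4 : (4 ^ n = 2 ^ (2 * n))%N by rewrite expnM.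
  by rewrite E4 /cover_prec -addnA hlfD mulrA hlf_natr mul1r.
have Hd : hlf n <= hlf (d + 2) by apply: hlf_le.
rewrite E in Hc; have := hlf_gt0 d.
have := hlfS d; have := hlfS d.+1; have := hlfS d.+2; rewrite addn2 in Hd; rewrite addn3 in Hc.
by lra.
Qed.

Lemma stuck_trace : exists r, [/\ omega_ce r, (forall n, W_card_le (r n) (4 ^ n)) &
  (forall n, inW (r n) (f n))].
Proof.
have [R CR HR] := enumeration comp_tested.
have [R1 CR1 HR1] : exists2 r : nat -> nat, (forall B, Acomputable B r) &
    forall e k, inWA emptyset (r e) k <-> exists s : nat, k == e.
  by apply: (@enumeration emptyset nat _ (fun e k _ => k == e)); comp_tac.
(* Below [n0] the two preceding lemmas do not apply; there the trace is the singleton of [f n], read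
   off a fixed finite list. *)
pose n0 := maxn i (d + 2).
pose Lf := [seq f n | n <- iota 0 n0].
pose r n := if (n < n0)%N then R1 (nth 0%N Lf n) else R (n, indices n).
exists r; split.
- apply/omega_ce_byP; have Oi : oce emptyset indices.
    have CC : Acomputable emptyset cut by rewrite /cut /cover_prec; comp_tac.
    have O1 : oce emptyset (fun n => [seq v l | l <- iota 0 (cut n)]).
      by apply: (oce_list (idx := fun _ l => l) v_oce); comp_tac.
    by apply: (oce_comp (p := fun n D => flatten D) O1); comp_tac.
  apply: (oce_comp (p := fun n D => if (n < n0)%N then R1 (nth 0%N Lf n) else R (n, D)) Oi).
  by have CR' := CR emptyset; have CR1' := CR1 emptyset; comp_tac.
- move=> n L uL HL; rewrite /r in HL; case: ifP HL => Hn HL.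
    have S : {subset L <= [:: nth 0%N Lf n]}.
      by move=> x /HL /HR1[_]; rewrite inE.
    apply: leq_trans (uniq_leq_size uL S) _; exact: expn_gt0.
  apply: (tested_card (n := n)) => //; first by rewrite /n0 in Hn; lia.
  by move=> k /HL /HR.
- move=> n; rewrite /r; case: ifP => Hn.
    apply/HR1; exists 0%N; rewrite /Lf (nth_map 0%N) ?size_iota // nth_iota //.
  apply/HR; apply: tested_self; rewrite /n0 in Hn; lia.
Qed.

End Trace.

(** * Lowness implies traceability *)

(* Indexing the tests by programs makes them countable, so that one real can
   escape them all. *)
Definition demuth_test (i : nat) (g : nat -> nat) :=
  (exists (G : nat -> nat -> nat) (b : nat -> nat),
    [/\ forall x t, Phi emptyset i (cpair x t) (G x t), computable b, is_limit G g &
        forall x, changes_bounded G x (b x)]) /\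
  forall m, measure_le emptyset (g m) m.

Lemma demuth_test_uniq i g g' : demuth_test i g -> demuth_test i g' -> g =1 g'.
Proof.
move=> [[G [b [H1 _ H2 _]]] _] [[G' [b' [H1' _ H2' _]]] _] x.
have [s Hs] := H2 x; have [s' Hs'] := H2' x.
rewrite -(Hs (maxn s s') (leq_maxl _ _)) -(Hs' (maxn s s') (leq_maxr _ _)).
exact: evalsto_det (H1 x _) (H1' x _).
Qed.

Lemma demuth_test_oce i g : demuth_test i g -> oce emptyset g.
Proof.
move=> [[G [b [H1 H2 H3 H4]]] _]; apply/omega_ce_byP; exists G, b; split=> //.
by exists i.
Qed.

Lemma demuth_test_exists g : omega_ce g -> (forall m, measure_le emptyset (g m) m) ->
  exists i, demuth_test i g.
Proof. by move=> [G [b [[i H1] H2 H3 H4]]] H; exists i; split=> //; exists G, b. Qed.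

Lemma test_tail_measure g G L N : (forall m, measure_le emptyset (g m) m) ->
  (forall x, x \in L -> exists2 l, (G <= l)%N & inW (g l) x) ->
  lam N (cov L) <= 2 * hlf G.
Proof.
move=> Hg HL.
(* A finite list meets only finitely many levels, so a finite geometric sum bounds its measure. *)
have [B HB] : exists B, forall x, x \in L -> exists2 l, (G <= l < G + B)%N & inW (g l) x.
  elim: L HL => [|x L IH] HL; first by exists 0%N.
  have [B HB] := IH (fun y Hy => HL y (mem_behead (s := x :: L) Hy)).
  have [l Hl Hx] := HL x (mem_head _ _); exists (maxn B l.+1) => y.
  rewrite inE => /orP[/eqP ->|/HB[l' Hl' Hy]]; first by exists l => //; lia.
  by exists l' => //; lia.
apply: le_trans (sum_hlf G B).
elim: B L HB {HL} => [|B IH] L HB.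
  rewrite big_nil (_ : L = [::]); first by rewrite /lam /cnt (eq_count (a2 := pred0)) // count_pred0 mul0r.
  by case: L HB => // x L HB; have [l] := HB x (mem_head _ _); lia.
have [L1 [L2 [H1 H2 S]]] := split_list (P := fun x => exists2 l, (G <= l < G + B)%N & inW (g l) x)
  (Q := fun x => inW (g (G + B)%N) x) (L := L)
  ltac:(by move=> x /HB[l Hl Hx]; case: (ltnP l (G + B)) => Hc;
     [left; exists l => //; lia|right; have <- : l = (G + B)%N by lia]).
rewrite -addn1 iotaD big_cat /= big_cons big_nil addr0.
apply: le_trans (lerD (IH L1 H1) ((measure_leP _ _ _).1 (Hg _) L2 N H2)).
apply: le_trans (lam_or _ _ _); apply: le_lam => t _ /(cov_sub S).
by rewrite cov_cat.
Qed.

Lemma mkseq_prefix (Z : nat -> bool) N N' : (N <= N')%N -> prefix (mkseq Z N) (mkseq Z N').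
Proof.
by move=> H; rewrite prefixE size_mkseq /mkseq -map_take take_iota (minn_idPl H).
Qed.

(** A forcing condition: it stands for the reals that extend [stem] and avoid all [banned] strings.
    [weight] and [depth] hold the constants of [tails_le] and [large]. *)
Record condition := Cond {
  stem : seq bool;
  banned : nat -> seq nat;
  weight : nat;
  depth : nat }.

Definition admissible (p : condition) := [/\ oce emptyset (banned p), tails_le (banned p) (weight p) &
  large (stem p) (at_some_level (banned p)) (depth p)].

Section Construction.
Context (f : nat -> nat).

Definition extends (i : nat) (p q : condition) :=
  [/\ prefix (stem p) (stem q),
      (exists2 n, (i < n)%N & zero_block n (f n) (stem q)),
      (forall x, at_some_level (banned p) x -> at_some_level (banned q) x) &
      forall g, demuth_test i g -> exists m, forall l x, (m <= l)%N -> inW (g l) x ->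
        at_some_level (banned q) x].

Hypothesis no_trace : ~ exists r, [/\ omega_ce r, (forall n, W_card_le (r n) (4 ^ n)) &
  (forall n, inW (r n) (f n))].

(** If no large extension carried a block for [f] beyond [i], then [stuck_trace] would trace [f].
    After such an extension, the test with index [i], if there is one, is banned from a high level
    on. *)
Lemma extend i p : admissible p -> exists2 q, admissible q & extends i p q.
Proof.
case: p => s v C d [/= Ov Tv Lv].
have [n [t [d' [Hn Hp Hz Hl]]]] : exists n t d', [/\ (i < n)%N, prefix s t, zero_block n (f n) t &
    large t (at_some_level v) d'].
  apply: NNPP => Hno; apply: no_trace.
  apply: (@stuck_trace f s v C d i.+1 Ov Tv Lv) => n t d' Hn Hp Hz Hl.
  by apply: Hno; exists n, t, d'.
case: (classic (exists g, demuth_test i g)) => [[g Hg]|Ng]; last first.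
  exists (Cond t v C d'); first by split.
  by split=> //=; [exists n|move=> g Hg; case: Ng; exists g].
(* The tail from [d'.+2] on weighs at most 2^-(d'+1), half of what is left, so depth [d'.+1]
   remains. *)
pose m := d'.+2.
pose v' l := if (m <= l)%N then g l :: v l else v l.
have lev l x : at_level v' l x -> at_level v l x \/ ((m <= l)%N /\ inW (g l) x).
  rewrite /at_level /v'; case: ifP => Hm [e He Hx]; last by left; exists e.
  move: He; rewrite inE => /orP[/eqP E|He]; last by left; exists e.
  by right; rewrite -E.
have Hg2 := Hg.2.
exists (Cond t v' (C + 2) d'.+1).
  split=> /=.
  - have O := oce_pair (demuth_test_oce Hg) Ov.
    by apply: (oce_comp (p := fun l w => if (m <= l)%N then w.1 :: w.2 else w.2) O); comp_tac.
  - move=> G L N HL.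
    have [L1 [L2 [H1 H2 S]]] := split_list (P := fun x => exists2 l, (G <= l)%N & at_level v l x)
      (Q := fun x => exists2 l, (G <= l)%N & inW (g l) x) (L := L)
      ltac:(by move=> x /HL[l Hc /lev[?|[_ ?]]]; [left|right]; exists l).
    apply: (@le_trans _ _ (lam N (cov L1) + lam N (cov L2))).
      apply: le_trans (lam_or _ _ _); apply: le_lam => u _ /(cov_sub S).
      by rewrite cov_cat.
    rewrite natrD mulrDl; apply: lerD; first exact: Tv.
    exact: test_tail_measure.
  - move=> L N HN HL.
    have [L1 [L2 [H1 H2 S]]] := split_list (P := at_some_level v)
      (Q := fun x => exists2 l, (m <= l)%N & inW (g l) x) (L := L)
      ltac:(by move=> x /HL[l /lev[?|[? ?]]]; [left|right]; exists l).
    have B1 := Hl L1 N HN H1.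
    have B2 := test_tail_measure N Hg2 H2.
    have B3 := lam_uncov N (prefix t) S.
    by have := hlfS d'; have := hlfS d'.+1; rewrite -/m; lra.
split=> //=.
- by exists n.
- move=> x [l [e He Hx]]; exists l, e => //; rewrite /v'; case: ifP => // _.
  by rewrite inE He orbT.
- move=> g' Hg'; exists m => l x Hm Hx; exists l, (g l); last by rewrite (demuth_test_uniq Hg Hg').
  by rewrite /v' Hm mem_head.
Qed.

Lemma generic_sequence : exists P : nat -> condition, forall i, admissible (P i) /\ extends i (P i) (P i.+1).
Proof.
have admissible0 : admissible (Cond [::] (fun _ => [::]) 0 0).
  split=> /=.
  - exact: oce_const.
  - move=> G [|x L] N HL; last by have [l _ [e]] := HL x (mem_head _ _).
    by rewrite mul0r /lam /cnt (eq_count (a2 := pred0)) // count_pred0 mul0r.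
  - move=> [|x L] N _ HL; last by have [l [e]] := HL x (mem_head _ _).
    by rewrite hlf0 -(lamT N); apply: le_lam => t _ _; rewrite prefix0s.
have [F HF] : exists F : nat * {p | admissible p} -> {p | admissible p}, forall x, extends x.1 (sval x.2) (sval (F x)).
  apply: (choice (fun (x : nat * {p | admissible p}) (q : {p | admissible p}) => extends x.1 (sval x.2) (sval q))) => -[i [p Hp]] /=.
  by have [q Hq E] := extend i Hp; exists (exist _ q Hq).
pose fix P (n : nat) : {p | admissible p} := if n is i.+1 then F (i, P i) else exist _ _ admissible0.
exists (fun n => sval (P n)) => i; split; first exact: (svalP (P i)).
exact: (HF (i, P i)).
Qed.

(** The real is the limit of the stems. A prefix of it in the banned tail of a test would be a
    prefix of some later stem, whose whole cone would then be covered by banned strings, against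
    [large]. *)
Lemma generic_real : exists Z, Demuth_random Z /\
  forall i, exists2 n, (i < n)%N & exists2 N, (0 < N)%N & zero_block n (f n) (mkseq Z N).
Proof.
have [P HP] := generic_sequence.
have mono i j : (i <= j)%N -> prefix (stem (P i)) (stem (P j)).
  move=> H; rewrite -(subnKC H); elim: (j - i)%N => [|k IH]; first by rewrite addn0 prefix_refl.
  by rewrite addnS; apply: prefix_trans IH _; have [_ []] := HP (i + k)%N.
have umono i j x : (i <= j)%N -> at_some_level (banned (P i)) x -> at_some_level (banned (P j)) x.
  move=> H Hx; rewrite -(subnKC H); elim: (j - i)%N => [|k IH]; first by rewrite addn0.
  by rewrite addnS; have [_ [_ _ U _]] := HP (i + k)%N; apply: U.
(* The zero block of order [n > i] inside the stem forces its length, so every bit of the limit gets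
   decided. *)
have siz i : (i < size (stem (P i.+1)))%N.
  have [_ [_ [n Hn Hz] _ _]] := HP i.
  by have := zero_block_size Hz; nia.
pose Z j := nth false (stem (P j.+1)) j.
have HZ i : stem (P i) = mkseq Z (size (stem (P i))).
  apply: (@eq_from_nth _ false); first by rewrite size_mkseq.
  move=> j Hj; rewrite nth_mkseq // /Z.
  case/orP: (leq_total i j.+1) => Hij.
    by have /prefixP[u ->] := mono _ _ Hij; rewrite nth_cat Hj.
  by have /prefixP[u ->] := mono _ _ Hij; rewrite nth_cat siz.
exists Z; split; last first.
  move=> i; have [_ [_ [n Hn Hz] _ _]] := HP i; exists n => //.
  exists (size (stem (P i.+1))); last by rewrite -HZ.
  by have := siz i; lia.
move=> g Og Hg; have [i Hi] := demuth_test_exists Og Hg.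
have [_ [_ _ _ Hb]] := HP i; have [m Hm] := Hb g Hi.
exists m => l Hl [x [Hx Hpre]].
have Hu := Hm l x Hl Hx.
(* Late enough for the test [i] to be banned and for the stem to be at least as long as the string
   of [x]. *)
pose j := maxn i.+1 (size (str_of_nat x)).+1.
have Hj : (size (str_of_nat x) <= size (stem (P j)))%N.
  have := siz j.-1; have -> : j.-1.+1 = j by rewrite /j; lia.
  by rewrite /j; lia.
have [[_ _ Lj] _] := HP j.
have Ux y : y \in [:: x] -> at_some_level (banned (P j)) y.
  by rewrite inE => /eqP ->; apply: umono Hu; rewrite /j; lia.
have := Lj [:: x] (size (stem (P j))) (leqnn _) Ux.
rewrite (@eq_lam _ _ pred0); first by rewrite /lam /cnt count_pred0 mul0r leNgt hlf_gt0.
move=> t Ht; apply/negP => /andP[]; rewrite prefixE -Ht take_size => /eqP Et.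
move=> /negP; apply; rewrite /cov /= orbF Et HZ Hpre.
exact: mkseq_prefix.
Qed.

End Construction.

(** The order function 4^n serves all [f] at once. An untraced [f] yields a Demuth random real in
    infinitely many block sets of [f], which together form a test relative to [A]. *)
Lemma low_traceable A : low_for_Demuth_BLR A -> BLR_traceable A.
Proof.
move=> low; exists (fun n => 4 ^ n)%N; split.
  split.
  - by apply/A_computableP; comp_tac.
  - by move=> n m H; rewrite leq_exp2l.
  - by move=> b; exists b; apply: ltn_expl.
move=> f Of; apply: NNPP => Hno.
have [Z [RZ HZ]] := generic_real Hno.
(* [R (n, f n)] will index the strings that already contain the zero block number [f n] of length
   [n]. *)
have [R CR HR] : exists2 r : nat * nat -> nat, (forall B, Acomputable B r) &
    forall v k, inWA A (r v) k <-> exists s : nat, zero_block v.1 v.2 (str_of_nat k).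
  by apply: (@enumeration A (nat * nat)%type _ (fun v k _ => zero_block v.1 v.2 (str_of_nat k))); comp_tac.
have Os : omega_ce_by A (fun n => R (n, f n)).
  apply/omega_ce_byP; apply: (oce_comp (p := fun n e => R (n, e)) ((omega_ce_byP _ _).1 Of)).
  by have CR' := CR A; comp_tac.
have Ms n : measure_le A (R (n, f n)) n.
  apply/measure_leP => L N HL; apply: le_trans (lam_zero_block n (f n) N).
  apply: le_lam => t _ /hasP[y /HL /HR[_ /= Hz] Hp]; exact: zero_block_prefix Hz.
have [M HM] := low Z RZ _ Os Ms.
have [n Hn [N _ Hz]] := HZ M.
apply: (HM n (ltnW Hn)); exists (nat_of_str (mkseq Z N)).
rewrite nat_of_strK; split; last by rewrite /is_prefix_of size_mkseq.
by apply/HR; exists 0%N; rewrite /= nat_of_strK.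
Qed.

Theorem mainTheorem4 (A : nat -> bool) :
  BLR_traceable A <-> low_for_Demuth_BLR A.
Proof. by split; [apply: traceable_low|apply: low_traceable]. Qed.
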